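(* Let $k$ be an algebraically closed field and let $A=\oplus_{n\ge 0}A_n$ be a standard graded algebra over $k$ with $d=\dim A\ge 1$. With $Q_u$, $M_n$, $h_n$, $r$ and the set $\mathcal{S}$ of admissible sequences as defined in the context, put $J = I_{h_{r+1}}(M_{r+1})\subseteq k[u]$. Then $$\operatorname{core}(A) = \bigcap_{(a_1,\ldots,a_r) \in \mathcal{S}}\Big[\Big(Q_u + \sum_{n=1}^r \sqrt{I_{a_n+1}(M_n)}\Big):J\prod_{n=1}^rI_{a_n}(M_n) \Big]\cap A,$$ where ideals of $k[u]$ are extended to $A[u]$, radicals are taken in $k[u]$, and colon ideals are taken in $A[u]$.
   Context: A reduction of $A$ is a graded ideal $Q$ of $A$ generated by linear forms (elements of $A_1$) such that $Q_n=A_n$ for all large $n$; a minimal reduction is one minimal with respect to inclusion. $\operatorname{core}(A)$ is the intersection of all reductions of $A$ (equivalently of all minimal reductions). Let $x_1,\ldots,x_m$ be linear forms generating the vector space $A_1$, and let $N=dm-1$. For $\alpha=(\alpha_{ij}\mid 1\le i\le d,\,1\le j\le m)\in\mathbb{P}^N_k$ let $Q_\alpha$ be the ideal of $A$ generated by the $d$ linear forms $y_i=\alpha_{i1}x_1+\cdots+\alpha_{im}x_m$, $i=1,\ldots,d$. Let $u=(u_{ij}\mid 1\le i\le d,\,1\le j\le m)$ be indeterminates, let $z_i=u_{i1}x_1+\cdots+u_{im}x_m\in A[u]$ for $i=1,\ldots,d$, and let $Q_u=(z_1,\ldots,z_d)\subseteq A[u]$. For every $n\ge0$ fix a $k$-basis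 $\mathcal{B}_n$ of $A_n$, and put $h_n=\dim_kA_n$. For $n\ge1$, write every element $z_if$ with $1\le i\le d$, $f\in\mathcal{B}_{n-1}$, as a linear combination of the elements of $\mathcal{B}_n$ with coefficients in $k[u]$; $M_n$ is the matrix of these coefficients (rows indexed by the elements $z_if$, columns by $\mathcal{B}_n$). For $t\ge0$, $I_t(M_n)$ is the ideal of $k[u]$ generated by the $t$-minors of $M_n$ (with $I_0=k[u]$, and $I_t=0$ if $t$ exceeds the size of the matrix). Let $V_{n,t}\subseteq\mathbb{P}^N_k$ be the zero locus of $I_t(M_n)$, let $V_n=V_{n,h_n}$ for $n\ge1$, and $V_0=\mathbb{P}^N_k$. The sequence $V_0\supseteq V_1\supseteq V_2\supseteq\cdots$ is non-increasing and eventually stationary; put $r=\max\{n\mid V_n\ne V_{n+1}\}$. For a sequence $H=\{a_1,\ldots,a_r\}$ of $r$ positive integers put $V_H=\bigcap_{n=1}^r\big(V_{n,a_n+1}\setminus(V_{n,a_n}\cup V_{r+1})\big)$. The sequence $H$ is called admissible if $V_H\neq\emptyset$, and $\mathcal{S}$ is the set of all admissible sequences. If $r=0$, $\mathcal{S}$ consists of the empty sequence only, and empty sums of ideals are $0$ and empty products are the unit ideal. *)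

(* Defs.v *)
From HB Require Import structures.
From mathcomp Require Import all_boot all_order all_algebra.
From mathcomp Require Import classical_sets.
From mathcomp Require Import mpoly.

Set Implicit Arguments.
Unset Strict Implicit.
Unset Printing Implicit Defensive.

Import GRing.Theory.
Local Open Scope classical_set_scope.
Local Open Scope ring_scope.

(** * Ideals of commutative rings *)

(* Ideals are arbitrary (not necessarily decidable or proper) subsets, unlike
   the boolean, proper ideals of [ring_quotient]. *)
Definition is_ideal (R : comNzRingType) (I : set R) : Prop :=
  [/\ I 0, forall x y, I x -> I y -> I (x + y) & forall a x, I x -> I (a * x)].

Definition ideal_gen (R : comNzRingType) (S : set R) : set R :=
  [set x | forall I : set R, is_ideal I -> S `<=` I -> I x].

Definition ideal_add (R : comNzRingType) (I J : set R) : set R :=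
  [set x | exists y z, [/\ I y, J z & x = y + z]].

Definition ideal_mul (R : comNzRingType) (I J : set R) : set R :=
  ideal_gen [set x | exists y z, [/\ I y, J z & x = y * z]].

Definition ideal_colon (R : comNzRingType) (I J : set R) : set R :=
  [set x | forall y, J y -> I (x * y)].

Definition radical (R : comNzRingType) (I : set R) : set R :=
  [set x | exists n : nat, I (x ^+ n)].

Definition is_prime_ideal (R : comNzRingType) (P : set R) : Prop :=
  [/\ is_ideal P, ~ P 1 & forall x y, P (x * y) -> P x \/ P y].

Definition has_prime_chain (R : comNzRingType) (n : nat) : Prop :=
  exists P : nat -> set R,
    (forall i, (i <= n)%N -> is_prime_ideal (P i)) /\
    (forall i, (i < n)%N -> P i `<` P i.+1).

Definition krull_dim_eq (R : comNzRingType) (d : nat) : Prop :=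
  has_prime_chain R d /\ (forall n, has_prime_chain R n -> (n <= d)%N).

(** * Standard graded algebras and their core *)

Section Graded.
Variables (k : closedFieldType) (A : comAlgType k).

Definition lin_spans (W : set A) (n : nat) (v : 'I_n -> A) : Prop :=
  (forall i, W (v i)) /\
  (forall y, W y -> exists c : 'I_n -> k, y = \sum_(i < n) c i *: v i).

Definition lin_basis (W : set A) (n : nat) (v : 'I_n -> A) : Prop :=
  lin_spans W v /\
  (forall c : 'I_n -> k, \sum_(i < n) c i *: v i = 0 -> forall i, c i = 0).

Record standard_graded (gr : nat -> set A) : Prop := StandardGraded {
  gr_zero : forall n, gr n 0;
  gr_add : forall n x y, gr n x -> gr n y -> gr n (x + y);
  gr_scale : forall n (c : k) x, gr n x -> gr n (c *: x);
  gr_mul : forall p q x y, gr p x -> gr q y -> gr (p + q)%N (x * y);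
  gr_decomp : forall x, exists n (c : nat -> A),
    (forall i, gr i (c i)) /\ x = \sum_(i < n) c i;
  gr_direct : forall n (c : nat -> A), (forall i, gr i (c i)) ->
    \sum_(i < n) c i = 0 -> forall i, (i < n)%N -> c i = 0;
  gr_connected : gr 0%N = range (fun c : k => c%:A);
  gr_fin_dim : exists n (v : 'I_n -> A), lin_spans (gr 1%N) v;
  gr_generated : forall B : set A,
    (forall c : k, B c%:A) ->
    (forall x y, B x -> B y -> B (x + y)) ->
    (forall x y, B x -> B y -> B (x * y)) ->
    gr 1%N `<=` B -> B = setT
}.

Variable gr : nat -> set A.

Definition is_graded_ideal (Q : set A) : Prop :=
  is_ideal Q /\
  (forall x, Q x -> exists n (c : nat -> A),
     (forall i, gr i (c i) /\ Q (c i)) /\ x = \sum_(i < n) c i).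

Definition is_reduction (Q : set A) : Prop :=
  [/\ is_graded_ideal Q,
      exists2 L : set A, L `<=` gr 1%N & Q = ideal_gen L
    & exists n0, forall n, (n0 <= n)%N -> gr n `<=` Q].

Definition core : set A := \bigcap_(Q in is_reduction) Q.

End Graded.

(** * Generic linear forms over [k[u]], with [u = (u_ij)] a [d * m] matrix *)

Definition gen_var (R : nzRingType) (d m : nat) (i : 'I_d) (j : 'I_m) :
  {mpoly R[d * m]} := 'X_(mxvec_index i j).

Definition gen_form (k : closedFieldType) (A : comAlgType k) (d m : nat)
    (x : 'I_m -> A) (i : 'I_d) : {mpoly A[d * m]} :=
  \sum_(j < m) gen_var A i j * (x j)%:MP.

Definition gen_ideal (k : closedFieldType) (A : comAlgType k) (d m : nat)
    (x : 'I_m -> A) : set {mpoly A[d * m]} :=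
  ideal_gen (range (@gen_form k A d m x)).
Arguments gen_ideal {k A} d {m} x.

Definition lift_poly (k : closedFieldType) (A : comAlgType k) (d m : nat) :
  {mpoly k[d * m]} -> {mpoly A[d * m]} := map_mpoly (in_alg A).

Definition ideal_ext (k : closedFieldType) (A : comAlgType k) (d m : nat)
    (I : set {mpoly k[d * m]}) : set {mpoly A[d * m]} :=
  ideal_gen (@lift_poly k A d m @` I).
Arguments ideal_ext {k} A {d m} I.

(* [M] expresses the products [z_i * f_j] in terms of the [g_l]; the row of
   [z_i * f_j] has index [mxvec_index i j].  When [g] is linearly independent
   over [k], this determines [M]. *)
Definition is_coef_matrix (k : closedFieldType) (A : comAlgType k) (d m : nat)
    (x : 'I_m -> A) (p q : nat) (f : 'I_p -> A) (g : 'I_q -> A)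
    (M : 'M[{mpoly k[d * m]}]_(d * p, q)) : Prop :=
  forall (i : 'I_d) (j : 'I_p),
    gen_form x i * (f j)%:MP =
    \sum_(l < q) lift_poly A (M (mxvec_index i j) l) * (g l)%:MP.

Definition minors_ideal (R : comNzRingType) (p q : nat) (t : nat)
    (M : 'M[R]_(p, q)) : set R :=
  ideal_gen [set y | exists (f : 'I_t -> 'I_p) (g : 'I_t -> 'I_q),
    [/\ {homo f : i j / (i < j)%N}, {homo g : i j / (i < j)%N}
      & y = \det (mxsub f g M)]].

(** * Loci in the projective space of [d * m] matrices *)

(* The projective space [P(V)], as the set of lines of [V]. *)
Definition proj_space (k : fieldType) (V : vectType k) : Type :=
  {L : {vspace V} | \dim L == 1%N}.

Definition zero_locus (k : closedFieldType) (d m : nat)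
    (I : set {mpoly k[d * m]}) : set (proj_space 'M[k]_(d, m)) :=
  [set L : proj_space 'M[k]_(d, m) |
     forall a : 'M[k]_(d, m), a \in sval L -> a != 0 ->
     forall F, I F -> F.@[mxvec a 0] = 0].

Section Loci.
Variables (k : closedFieldType) (d m : nat) (h : nat -> nat).
(* [M n] is relevant for [n >= 1] only. *)
Variable M : forall n, 'M[{mpoly k[d * m]}]_(d * h n.-1, h n).

Definition rank_locus (n t : nat) : set (proj_space 'M[k]_(d, m)) :=
  zero_locus (minors_ideal t (M n)).

Definition full_locus (n : nat) : set (proj_space 'M[k]_(d, m)) :=
  if n is 0%N then setT else rank_locus n (h n).

Definition is_last_jump (r : nat) : Prop :=
  full_locus r <> full_locus r.+1 /\
  (forall n, full_locus n <> full_locus n.+1 -> (n <= r)%N).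

(* A sequence [a_1, ..., a_r] is a tuple [a], [a_(n+1)] being [tnth a n]. *)
Definition seq_locus (r : nat) (a : r.-tuple nat) :
    set (proj_space 'M[k]_(d, m)) :=
  \bigcap_(n in [set: 'I_r])
    (rank_locus n.+1 (tnth a n).+1 `\`
       (rank_locus n.+1 (tnth a n) `|` full_locus r.+1)).

Definition admissible (r : nat) : set (r.-tuple nat) :=
  [set a | (forall n, (0 < tnth a n)%N) /\ seq_locus a !=set0].

Definition radical_sum (r : nat) (a : r.-tuple nat) : set {mpoly k[d * m]} :=
  \big[@ideal_add _/[set 0]]_(n < r)
    radical (minors_ideal (tnth a n).+1 (M n.+1)).

Definition minors_prod (r : nat) (a : r.-tuple nat) : set {mpoly k[d * m]} :=
  \big[@ideal_mul _/setT]_(n < r) minors_ideal (tnth a n) (M n.+1).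

End Loci.
Arguments admissible {k d m h} M r.

(* Main.v *)
Require Import Defs.
From HB Require Import structures.
From mathcomp Require Import all_boot all_order all_algebra.
From mathcomp Require Import classical_sets.
From mathcomp Require Import mpoly.
From mathcomp Require Import boolp perm ring.

Set Implicit Arguments.
Unset Strict Implicit.
Unset Printing Implicit Defensive.

Import GRing.Theory.
Local Open Scope classical_set_scope.
Local Open Scope ring_scope.

(** For a matrix [a] over [k], let [Q_a] be the ideal of [A] generated by the
    [d] linear forms with coefficient matrix [a], and call [a] good when [Q_a]
    contains the component [A_(r+1)].  In coordinates, the degree [n] part of
    [Q_a] is the row space of [M_n] specialized at [a] ([special_ideal_coord]);
    so membership of an element of degree [n] in [Q_a] is a rank condition,
    and [a] is good exactly when [J] does not vanish at [a].

    The core is the intersection of the ideals [Q_a] over the good [a].  One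
    inclusion holds because such a [Q_a] is a reduction ([core_sub_good]).  For
    the other one ([good_sub_core]), a reduction [Q] must contain [Q_a] for some
    good [a].  By [linear_parameters] there are [d] linear forms in [Q]
    generating an ideal that contains [A_n] for large [n]; since the loci [V_n]
    no longer change beyond [r+1], their coefficient matrix is good up to a
    scalar.  The bound [d] on the number of forms comes from an explicit chain
    of primes: if [t] linear forms of [Q] never suffice modulo a homogeneous
    ideal [I], then an ideal [P] containing [I] and maximal with this property
    is prime, because general [t]-tuples of forms would serve [P + (f)] and
    [P + (g)] simultaneously ([covered_mul]).  Adding to [P] a linear form
    of [Q] outside [P] decreases by at most one the number of forms that are
    needed, so the construction can be repeated, and [t] forms not being enough
    yields a chain of length [t + 1] ending at the irrelevant ideal
    ([uncovered_prime_chain]).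

    Given this description of the core, an element [w] of the right-hand side
    lies in [Q_a] for every good [a]: take for [a_n] the rank of [M_n] at [a]
    and evaluate the colon condition at [u = a]; the radicals vanish there, while
    some element of the product of ideals of minors does not
    ([bracket_sub_special]).

    Conversely let [w] be a homogeneous element of the core of degree [n].  If
    [n > r], Cramer's rule gives [J w] in [Q_u].  If [1 <= n <= r], let [D] be a
    [t]-minor of [M_n] with [t = a_n].  Cramer's rule shows that [D w] is, modulo
    [Q_u], the combination of the basis of [A_n] whose coefficients are the
    [t+1]-minors bordering [D] in the matrix [M_n] extended by the coordinate
    row of [w] ([cramer_bracket], [det_bordered]).  At a point [a] where
    [I_(t+1)(M_n)] vanishes, either [a] is not good and [J] vanishes, or [w]
    lies in [Q_a], so the coordinate row of [w] depends on the rows of [M_n] at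
    [a] and the bordering minors vanish.  By Hilbert's Nullstellensatz, the
    products of these minors with elements of [J] lie in the radical of
    [I_(t+1)(M_n)] ([minor_bracket]). *)

(** * Polynomial functions over an algebraically closed field *)

(** The coefficients of [p] can be read off those of [muni p], because a
    multinomial is determined by its last exponent and the other ones. *)
Lemma muni_inj0 (n : nat) (R : nzRingType) (p : {mpoly R[n.+1]}) :
  muni p = 0 -> p = 0.
Proof.
move=> p0; apply/mpolyP => m; rewrite mcoeff0.
have := muniE p; rewrite p0 => /(congr1 (fun q : {poly _} => q`_(m ord_max))).
move=> /(congr1 (mcoeff [multinom m (widen_ord (leqnSn n) i) | i < n])).
rewrite coef0 mcoeff0 coef_sum raddf_sum /= => ->.
have E m' : (p@_m' *: 'X_[[multinom m' (widen_ord (leqnSn n) i) | i < n]] *: 'X^(m' ord_max))`_(m ord_max)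
   @_[multinom m (widen_ord (leqnSn n) i) | i < n] = p@_m' * (m' == m)%:R.
  rewrite coefZ coefXn.
  have [->|ne] := eqVneq m' m; first by rewrite eqxx mulr1 mcoeffZ mcoeffX eqxx.
  have [e|] := eqVneq; last by rewrite mulr0 mcoeff0 mulr0.
  rewrite mulr1 mcoeffZ mcoeffX; have [E|] := eqVneq; last by [].
  case/eqP: ne; apply/mnmP => i.
  have [j ->|->] := unliftP ord_max i; last by rewrite e.
  have -> : lift ord_max j = widen_ord (leqnSn n) j by apply: val_inj; exact: (lift_max j).
  by have := congr1 (fun m : 'X_{1..n} => m j) E; rewrite !mnmE.
rewrite (eq_bigr _ (fun i _ => E i)).
have [mp|mp] := boolP (m \in msupp p).
  rewrite (bigD1_seq m) ?msupp_uniq //= eqxx mulr1 big1 ?addr0 // => i /negPf ->.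
  by rewrite mulr0.
rewrite memN_msupp_eq0 // big_seq big1 // => i ip.
by case: eqP ip mp => [-> ->|_ _ _] //; rewrite mulr0.
Qed.

Lemma rmorph_mmap (n : nat) (R : nzRingType) (S T : comNzRingType)
    (F : {rmorphism S -> T}) (f : {rmorphism R -> S}) (h : 'I_n -> S)
    (f' : {rmorphism R -> T}) (h' : 'I_n -> T) (p : {mpoly R[n]}) :
    (forall c, F (f c) = f' c) -> (forall i, F (h i) = h' i) ->
  F (mmap f h p) = mmap f' h' p.
Proof.
move=> Ff Fh; rewrite /mmap rmorph_sum; apply: eq_bigr => m _.
rewrite rmorphM Ff rmorph_prod; congr (_ * _); apply: eq_bigr => i _.
by rewrite rmorphXn Fh.
Qed.

(** Specialize first the variables of the leading coefficient with respect to
    the last variable, then the last variable. *)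
Lemma mpoly_nonroot (k : closedFieldType) (n : nat) (p : {mpoly k[n]}) :
  p != 0 -> exists a, p.@[a] != 0.
Proof.
elim: n p => [|n IH] p p0.
  exists (fun _ => 0); have pE : p = (p@_0)%:MP.
    apply: msize1_polyC; rewrite msizeE; apply/bigmax_leqP_seq => m _ _.
    by rewrite mdegE big_ord0.
  by rewrite pE mevalC; apply: contra p0; rewrite {2}pE => /eqP ->; rewrite mpolyC0.
have q0 : muni p != 0 by apply: contra p0 => /eqP /muni_inj0 ->.
have [a ha] := IH (lead_coef (muni p)) (etrans (f_equal negb (lead_coef_eq0 _)) q0).
have [c hc] : exists c, (map_poly (meval a) (muni p)).[c] != 0.
  apply/closed_nonrootP; apply: contra ha => /eqP E.
  by rewrite lead_coefE -coef_map E coef0.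
pose w (i : 'I_n.+1) := if unlift ord_max i is Some j then a j else c.
exists w; suff -> : p.@[w] = (map_poly (meval a) (muni p)).[c] by [].

apply/esym; rewrite /muni.
rewrite -[LHS]/((horner_eval c \o map_poly (meval a)) _).
apply: rmorph_mmap => [b|i] /=; first by rewrite map_polyC /= mevalC /horner_eval hornerC.
case: splitP => [j ij|j ij]; rewrite /w.
  rewrite map_polyC /= /horner_eval hornerC mevalXU.
  have -> : i = lift ord_max j by apply: val_inj; exact: (etrans ij (esym (lift_max j))).
  by rewrite liftK.
rewrite map_polyX /horner_eval hornerX.
have -> : i = ord_max; last by rewrite unlift_none.
by apply: val_inj; move: ij; rewrite /= ord1 addn0.
Qed.

(** The value [c] is the coefficient of degree [D], which may be zero: unlike
    a statement on leading coefficients, this one is multiplicative over any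
    ring. *)
Definition top_coef (R : nzRingType) (D : nat) (p : {poly R}) (c : R) : Prop :=
  (size p <= D.+1)%N /\ p`_D = c.

Lemma top_coefM (R : nzRingType) (D E : nat) (p q : {poly R}) (c e : R) :
  top_coef D p c -> top_coef E q e -> top_coef (D + E) (p * q) (c * e).
Proof.
move=> [sp <-] [sq <-]; split.
  apply: leq_trans (size_polyMleq _ _) _.
  by rewrite -subn1 leq_subLR add1n -addSn -addnS leq_add.
rewrite coefM (bigD1 (inord D)) //= inordK; last by rewrite ltnS leq_addr.
rewrite addKn big1 ?addr0 // => i iD.
have [lt|le] := ltnP D i; first by rewrite nth_default ?mul0r // (leq_trans sp).
have lt : (i < D)%N.
  rewrite ltn_neqAle le andbT; apply: contra iD => /eqP e'.
  by rewrite -val_eqE /= inordK ?e' // ltnS leq_addr.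
rewrite [X in _ * X]nth_default ?mulr0 // (leq_trans sq) //.
by rewrite ltn_subRL ltn_add2r.
Qed.

Lemma top_coef_mmap1 (R : comNzRingType) (n : nat) (P : 'I_n -> {poly R})
    (c : 'I_n -> R) (m : 'X_{1..n}) :
  (forall i, top_coef 1 (P i) (c i)) ->
  top_coef (mdeg m) (mmap1 P m) (mmap1 c m).
Proof.
move=> Pc; rewrite mdegE /mmap1.
apply: (big_rec3 (fun a b d => top_coef d b a)) => [|i a b d _].
  by split; rewrite ?size_poly1 // coef1.
apply: top_coefM; elim: (m i) => [|e IH]; first by split; rewrite ?size_poly1 // coef1.
by rewrite !exprS -add1n; apply: top_coefM.
Qed.

(** The leading coefficients must survive, since the size of the Sylvester
    matrix depends on the degrees of both polynomials. *)
Lemma rmorph_resultant (R S : nzRingType) (f : {rmorphism R -> S}) (p q : {poly R}) :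
  f (lead_coef p) != 0 -> f (lead_coef q) != 0 ->
  f (resultant p q) = resultant (map_poly f p) (map_poly f q).
Proof.
move=> nz_fp nz_fq; rewrite /resultant /Sylvester_mx !size_map_poly_id0 //.
rewrite -det_map_mx /= map_col_mx; congr (\det (col_mx _ _));
  by apply: map_lin1_mx => v; rewrite map_poly_rV rmorphM /= map_rVpoly.
Qed.

(** * Common zeros of proper ideals *)

Section WeakNullstellensatz.
Variables (k : closedFieldType) (C : comNzRingType) (phi : {rmorphism k -> C}).
Variable I : set C.
Hypotheses (idI : is_ideal I) (properI : ~ I 1).

Let I0 : I 0. Proof. by case: idI. Qed.
Let ID x y : I x -> I y -> I (x + y). Proof. by case: idI => _ + _; apply. Qed.
Let IM a x : I x -> I (a * x). Proof. by case: idI => _ _; apply. Qed.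

(** The substitution ['X_i := 'X_i + c_i T] for the first variables and ['X_n
    := c_n T] for the last one, where [T] is the variable of the outer
    polynomial ring.  For a general direction [c] it makes a polynomial monic
    in [T] up to a scalar. *)
Definition sub_lin (n : nat) (c : 'I_n.+1 -> k) (i : 'I_n.+1) : {poly {mpoly k[n]}} :=
  (if unlift ord_max i is Some j then 'X_j else 0)%:P + (c i)%:MP%:P * 'X.

(** Along the direction [c], the coefficient of [T^D] only sees the
    homogeneous part of degree [D]. *)
Lemma top_coef_sub_lin (n : nat) (c : 'I_n.+1 -> k) (D : nat) (p : {mpoly k[n.+1]}) :
  (msize p <= D.+1)%N ->
  top_coef D (mmap (polyC \o @mpolyC n k) (sub_lin c) p)
    ((pihomog mdeg D p).@[c])%:MP.
Proof.
move=> pD; have T m : top_coef (mdeg m) (mmap1 (sub_lin c) m) (mmap1 (fun i => (c i)%:MP) m).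
  apply: top_coef_mmap1 => i; rewrite /sub_lin; split.
    by rewrite addrC -cons_poly_def size_cons_poly; case: ifP => // _; rewrite ltnS size_polyC leq_b1.
  by rewrite coefD coefC /= coefMX coefC add0r.
have {}T m : m \in msupp p -> ((mdeg m <= D)%N /\ top_coef (mdeg m) (mmap1 (sub_lin c) m)
   (mmap1 c m)%:MP).
  move=> mp; split; first by rewrite -ltnS (leq_trans _ pD) // msize_mdeg_lt.
  suff -> : (mmap1 c m)%:MP = mmap1 (fun i => (c i)%:MP_[n]) m by [].
  by rewrite /mmap1 rmorph_prod; apply: eq_bigr => i _; rewrite rmorphXn.
split.
  rewrite /mmap big_seq; apply: (big_ind (fun q : {poly _} => size q <= D.+1)%N) => [|q1 q2 h1 h2|m mp].
  - by rewrite size_poly0.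
  - by apply: leq_trans (size_polyD _ _) _; rewrite geq_max h1.
  case: (T m mp) => mD [sm _] /=; rewrite mul_polyC.
  apply: leq_trans (size_scale_leq _ _) _; exact: leq_trans sm _.
rewrite pihomogE (raddf_sum (meval c)) /= (raddf_sum (@mpolyC n k)) /mmap coef_sum /= [RHS]big_mkcond /= big_seq [RHS]big_seq.
apply: eq_bigr => m mp; case: (T m mp) => mD [sm _].
rewrite coefCM; case: eqP => [mE|mN]; last first.
  rewrite nth_default ?mulr0 //; apply: leq_trans sm _.
  by rewrite ltn_neqAle mD andbT; apply/eqP.
by rewrite mevalZ mevalX mpolyCM -mE; case: (T m mp) => _ [_ ->].
Qed.

(** By induction on [n].  If the [v_i] satisfy no relation modulo [I], every
    point works.  Otherwise, after a linear change of the [v_i], the last one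
    satisfies modulo [I] a monic equation [q] over the other ones, for which
    the induction hypothesis provides a point [a'].  The polynomials [G] with
    [G(v', w)] in [I], specialized at [a'], form an ideal of [k[T]]; it does
    not contain [1], since otherwise the resultant of [G] and [q], which lies
    in [I] after evaluation at [v'], would not vanish at [a'].  A root of this
    ideal is the last coordinate. *)
Lemma weak_nullstellensatz (n : nat) (v : 'I_n -> C) :
  exists a : 'I_n -> k, forall p, I (mmap phi v p) -> p.@[a] = 0.
Proof.
have unitI c : c != 0 -> ~ I (phi c).
  by move=> c0 /(IM (phi c^-1)); rewrite -rmorphM mulVf // rmorph1.
elim: n v => [|n IH] v.
  exists (fun _ => 0) => p; have -> : p = (p@_0)%:MP.
    apply: msize1_polyC; rewrite msizeE; apply/bigmax_leqP_seq => m _ _.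
    by rewrite mdegE big_ord0.
  rewrite mmapC mevalC => Ip; apply: contrapT => /eqP p0; exact: (unitI _ p0).
have [free|] := pselect (forall p, I (mmap phi v p) -> p = 0).
  by exists (fun _ => 0) => p /free ->; rewrite meval0.
move/existsNP => [p /not_implyP [Ip /eqP p0]].
pose D := (msize p).-1; have pD : msize p = D.+1 by rewrite /D -mlead_deg.
(* The factor ['X_ord_max] forces [c ord_max != 0], so that [T] can be solved for. *)
have [c] : exists c, (pihomog mdeg D p * 'X_ord_max).@[c] != 0.
  apply: mpoly_nonroot; rewrite mulf_neq0 //; last by rewrite -msupp_eq0 msuppX.
  apply/eqP => /(congr1 (mcoeff (mlead p))) E; move/eqP: (p0); apply; apply/eqP.
  rewrite -mleadc_eq0; suff <- : (pihomog mdeg D p)@_(mlead p) = mleadc p by rewrite E mcoeff0.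
  rewrite pihomogE raddf_sum /= big_mkcond (bigD1_seq (mlead p)) ?msupp_uniq ?mlead_supp //=.
  rewrite /D -mlead_deg //= eqxx mcoeffZ mcoeffX eqxx mulr1 big1 ?addr0 // => i /negPf ne.
  by rewrite mcoeffZ mcoeffX ne mulr0; case: ifP.
rewrite mevalM mevalXU mulf_eq0 negb_or => /andP [ptop0 cmax0].
pose w := phi (c ord_max)^-1 * v ord_max.
pose v' (j : 'I_n) := v (lift ord_max j) - phi (c (lift ord_max j)) * w.
have [a' ha'] := IH v'.
pose Phi (G : {poly {mpoly k[n]}}) := (map_poly (mmap phi v') G).[w].
have PhiE G : Phi G = (horner_eval w \o map_poly (mmap phi v')) G by [].
have PhiM G H : Phi (G * H) = Phi G * Phi H by rewrite !PhiE rmorphM.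
have PhiD G H : Phi (G + H) = Phi G + Phi H by rewrite !PhiE rmorphD.
have PhiC f : Phi f%:P = mmap phi v' f by rewrite /Phi map_polyC hornerC.
have PhiX : Phi 'X = w by rewrite /Phi map_polyX hornerX.
have Phi_mmap q : Phi (mmap (polyC \o @mpolyC n k) (sub_lin c) q) = mmap phi v q.
  rewrite PhiE; apply: rmorph_mmap => [b|i].
    by rewrite -[LHS]/(Phi b%:MP%:P) PhiC mmapC.
  rewrite -[LHS]/(Phi (sub_lin c i)) /sub_lin; case: unliftP => [j ->|->]; rewrite PhiD PhiM !PhiC PhiX (mmapC v' phi (c _)).
    by rewrite mmapX mmap1U /v' subrK.
  by rewrite mmap0 add0r /w mulrA -rmorphM mulfV // rmorph1 mul1r.
have [sq cq] := @top_coef_sub_lin n c D p (eq_leq pD).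
pose q := ((pihomog mdeg D p).@[c])^-1%:MP%:P * mmap (polyC \o @mpolyC n k) (sub_lin c) p.
have Iq : I (Phi q) by rewrite PhiM Phi_mmap; apply: IM.
have qD : q`_D = 1 by rewrite coefCM cq -mpolyCM mulVf.
have sqD : size q = D.+1.
  apply/eqP; rewrite eqn_leq; apply/andP; split.
    by rewrite /q mul_polyC (leq_trans (size_scale_leq _ _)).
  rewrite ltnNge; apply/negP => /leq_sizeP /(_ D (leqnn _)) /eqP.
  by rewrite qD oner_eq0.
have qmonic : q \is monic by apply/monicP; rewrite lead_coefE sqD.
pose ev : {poly {mpoly k[n]}} -> {poly k} := map_poly (meval a').
have q'monic : ev q \is monic by apply: monic_map.
pose L : set {poly k} := [set g | exists2 G, I (Phi G) & g = ev G].
have Lq : L (ev q) by exists q.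
have LD f g : L f -> L g -> L (f + g).
  by move=> [F HF ->] [G HG ->]; exists (F + G); rewrite ?PhiD /ev ?rmorphD //; apply: ID.
have LM f g : L g -> L (f * g).
  move=> [G HG ->]; exists (map_poly (@mpolyC n k) f * G); first by rewrite PhiM; apply: IM.
  rewrite /ev rmorphM /= -map_poly_comp; congr (_ * _).
  by rewrite map_poly_id // => x _ /=; rewrite mevalC.
have L1 : ~ L 1.
  move=> [G IG E]; pose e := size G.
  have sqpos : (1 < size q)%N.
    rewrite ltnNge; apply/negP => /size1_polyC qC.
    have D0 : D = 0%N.
      by move: sqD; rewrite qC size_polyC; case: (_ == _) => //= -[<-].
    by apply: properI; move: Iq; rewrite qC -D0 qD PhiC rmorph1.
  (* Adding a large multiple of [q] makes [G] monic: its degree does not drop at [a']. *)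
  pose G2 := q * 'X^e + G.
  have ltGq : (size G < size (q * 'X^e)%R)%N.
    by rewrite size_Mmonic ?monicXn ?monic_neq0 // size_polyXn addnS /= sqD addSn ltnS leq_addl.
  have G2monic : G2 \is monic.
    by rewrite monicE (lead_coefDl ltGq) -monicE (monicMl _ qmonic) monicXn.
  have sG2 : (1 < size G2)%N.
    rewrite size_polyDl // size_Mmonic ?monicXn ?monic_neq0 // size_polyXn addnS /=.
    by rewrite (leq_trans sqpos) // leq_addr.
  have [[u1 u2] _ /= resE] := resultant_in_ideal sG2 sqpos.
  have res0 : (resultant G2 q).@[a'] = 0.
    apply: ha'; rewrite -PhiC resE PhiD (PhiM u1) (PhiM u2); apply: ID; apply: IM => //.
    by rewrite PhiD (PhiM q) mulrC; apply: ID => //; apply: IM.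
  have ev_lead G' : G' \is monic -> (lead_coef G').@[a'] != 0.
    by move=> /monicP ->; rewrite rmorph1 oner_eq0.
  move: (resultant_eq0 (ev G2) (ev q)); rewrite -rmorph_resultant ?ev_lead //.
  rewrite [X in X == _]res0 eqxx => /esym; apply/negP; rewrite -leqNgt.
  have -> : ev G2 = ev ('X^e) * ev q + 1 by rewrite E /ev rmorphD rmorphM mulrC.
  have : coprimep (ev ('X^e) * ev q + 1) (ev q).
    by rewrite coprimep_sym coprimep_addl_mul coprimep1.
  by rewrite coprimep_def => /eqP ->.
pose Q s := `[< exists2 g, L g & g != 0 /\ size g = s >].
have [s /asboolP [g Lg [g0 sg]] smin] : {s | Q s & forall s', Q s' -> (s <= s')%N}.
  have ex : exists s, Q s.
    by exists (size (ev q)); apply/asboolP; exists (ev q) => //; split=> //; apply: monic_neq0.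
  by exists (ex_minn ex); case: ex_minnP.
have gdiv f : L f -> g %| f.
  move=> Lf; rewrite /dvdp; apply: contrapT => /negP r0.
  have : Q (size (f %% g)).
    apply/asboolP; exists (f %% g) => //; rewrite -[_ %% _](addKr (f %/ g * g)) -divp_eq addrC.
    by apply: LD => //; rewrite -mulNr; apply: LM.
  by move/smin; rewrite -sg leqNgt ltn_modp g0.
have sg1 : size g != 1%N.
  apply/negP => /size_poly1P [b b0 gb]; apply: L1.
  have -> : 1 = b^-1%:P * g by rewrite gb -polyCM mulVf.
  exact: LM.
have [t rt] := closed_rootP g sg1.
pose a (i : 'I_n.+1) := (if unlift ord_max i is Some j then a' j else 0) + c i * t.
exists a => f If; have <- : (ev (mmap (polyC \o @mpolyC n k) (sub_lin c) f)).[t] = f.@[a].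
  rewrite -[LHS]/((horner_eval t \o map_poly (meval a')) _).
  apply: rmorph_mmap => [b|i] /=; first by rewrite map_polyC /= mevalC /horner_eval hornerC.
  rewrite /sub_lin /a /horner_eval rmorphD rmorphM /= !map_polyC map_polyX !hornerE /= mevalC.
  by case: unliftP => [j _|_]; rewrite ?mevalXU ?meval0.
apply/eqP; apply: (root_dvdp (gdiv _ _) rt).
by exists (mmap (polyC \o @mpolyC n k) (sub_lin c) f); rewrite ?Phi_mmap.
Qed.
End WeakNullstellensatz.

(** * The Nullstellensatz *)

Lemma idealN (R : comNzRingType) (I : set R) x : is_ideal I -> I x -> I (- x).
Proof. by case=> _ _ IM Ix; rewrite -mulN1r; apply: IM. Qed.

Lemma idealB (R : comNzRingType) (I : set R) x y : is_ideal I -> I x -> I y -> I (x - y).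
Proof. by move=> idI Ix Iy; case: (idI) => _ ID _; apply: ID => //; apply: idealN. Qed.

Lemma idealMr (R : comNzRingType) (I : set R) x a : is_ideal I -> I x -> I (x * a).
Proof. by case=> _ _ IM Ix; rewrite mulrC; apply: IM. Qed.

Lemma ideal_sum (R : comNzRingType) (I : set R) (T : Type) (r : seq T) (P : pred T) (F : T -> R) :
  is_ideal I -> (forall i, P i -> I (F i)) -> I (\sum_(i <- r | P i) F i).
Proof. by move=> [I0 ID _]; apply: big_ind. Qed.

Lemma mmap_mpolyX_id (n : nat) (R : comNzRingType) (p : {mpoly R[n]}) :
  mmap (@mpolyC n R) (fun i => 'X_i) p = p.
Proof.
rewrite [RHS]mpolyE /mmap; apply: eq_bigr => m _.
by rewrite mmap1_id mul_mpolyC.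
Qed.

(** Rabinowitsch's argument: [I] and [1 - f T] have no common zero, hence
    generate the unit ideal [E] of [k[X][T]].  Reducing the identity [1 = g +
    (1 - f T) h] modulo [I] shows by induction that the coefficient of [T^i]
    in [h] is congruent to [f^i], and it vanishes for large [i]. *)
Theorem nullstellensatz (k : closedFieldType) (n : nat) (I : set {mpoly k[n]})
    (f : {mpoly k[n]}) :
  is_ideal I ->
  (forall a : 'I_n -> k, (forall p, I p -> p.@[a] = 0) -> f.@[a] = 0) ->
  radical I f.
Proof.
move=> idI fV; have [I0 ID IM] := idI.
pose E : set {poly {mpoly k[n]}} :=
  [set x | exists g h : {poly {mpoly k[n]}}, (forall i, I g`_i) /\ x = g + (1 - f%:P * 'X) * h].
have idE : is_ideal E.
  split.
  - by exists 0, 0; split; [move=> i; rewrite coef0|rewrite mulr0 addr0].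
  - move=> _ _ [g1 [h1 [G1 ->]]] [g2 [h2 [G2 ->]]]; exists (g1 + g2), (h1 + h2).
    by split; [move=> i; rewrite coefD; apply: ID|rewrite mulrDr addrACA].
  - move=> a _ [g [h [G ->]]]; exists (a * g), (a * h); split; last by rewrite mulrDr mulrCA.
    by move=> i; rewrite coefM; apply: ideal_sum => // j _; apply: IM.
have [[g [h [G E1]]]|nE1] := pselect (E 1).
  have step i : I (h`_i - f ^+ i).
    elim: i => [|i IH].
      have := congr1 (fun p : {poly _} => p`_0) E1.
      rewrite coef1 coefD mulrBl mul1r coefB -mulrA coefCM coefXM mulr0 subr0 expr0 eqxx mulr1n => ->.
      by rewrite opprD addrCA subrr addr0; apply: idealN.
    have := congr1 (fun p : {poly _} => p`_i.+1) E1.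
    rewrite coef1 coefD mulrBl mul1r coefB -mulrA coefCM coefXM /= mulr0n => e.
    have -> : h`_i.+1 - f ^+ i.+1 = - g`_i.+1 + f * (h`_i - f ^+ i).
      by rewrite exprS -[LHS]subr0 [X in _ - X = _]e; ring.
    by apply: ID; [apply: idealN|apply: IM].
  exists (size h); have := step (size h).
  by rewrite nth_default // sub0r => /(idealN idI); rewrite opprK.
pose v (i : 'I_n.+1) : {poly {mpoly k[n]}} := if unlift ord_max i is Some j then ('X_j)%:P else 'X.
have [a ha] := weak_nullstellensatz (polyC \o @mpolyC n k) idE nE1 v.
pose a' j := a (lift ord_max j).
pose up p : {mpoly k[n.+1]} := mmap (@mpolyC n.+1 k) (fun j : 'I_n => 'X_(lift ord_max j)) p.
have upv p : mmap (polyC \o @mpolyC n k) v (up p) = p%:P.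
  rewrite -[in RHS](mmap_mpolyX_id p) [RHS](@rmorph_mmap _ _ _ _ polyC _ _ (polyC \o @mpolyC n k) (fun j => ('X_j)%:P)) //.
  apply: rmorph_mmap => [c|i]; first by rewrite /= mmapC.
  by rewrite /= mmapX mmap1U /v liftK.
have upa p : (up p).@[a] = p.@[a'].
  apply: (@rmorph_mmap _ _ _ _ (meval a) _ _ idfun a') => [c|i] /=; first by rewrite mevalC.
  by rewrite mevalXU.
have fa' : f.@[a'] = 0.
  apply: fV => p Ip; rewrite -upa; apply: ha; rewrite upv; exists p%:P, 0.
  by split; [move=> i; rewrite coefC; case: ifP|rewrite mulr0 addr0].
have : (1 - up f * 'X_ord_max).@[a] = 0.
  apply: ha; exists 0, 1; split; first by move=> i; rewrite coef0.
  rewrite mulr1 add0r rmorphB rmorph1 rmorphM /=.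
  rewrite -/(mmap _ _ _) upv; congr (1 - _ * _); rewrite mmapX mmap1U /v.
  by rewrite unlift_none.
by rewrite mevalB mevalM upa fa' mul0r subr0 meval1 => /eqP; rewrite oner_eq0.
Qed.

(** * Homogeneous components *)

Section GradedAlgebra.
Variables (k : closedFieldType) (A : comAlgType k) (gr : nat -> set A).
Hypothesis hA : standard_graded gr.

Lemma gr_sum n (T : Type) (r : seq T) (P : pred T) (F : T -> A) :
  (forall i, P i -> gr n (F i)) -> gr n (\sum_(i <- r | P i) F i).
Proof. by apply: big_ind; [exact: gr_zero|exact: gr_add]. Qed.

Lemma grB n x y : gr n x -> gr n y -> gr n (x - y).
Proof. by move=> gx gy; rewrite -scaleN1r; apply: (gr_add hA) => //; apply: gr_scale. Qed.

Lemma gr0_scalar (c : k) : gr 0 c%:A.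
Proof. by rewrite (gr_connected hA); exists c. Qed.

Lemma gr0_1 : gr 0 1.
Proof. by have := gr0_scalar 1; rewrite scale1r. Qed.

Definition homog_decomp (x : A) (d : nat * (nat -> A)) : Prop :=
  [/\ forall i, gr i (d.2 i), forall i, (d.1 <= i)%N -> d.2 i = 0
    & x = \sum_(i < d.1) d.2 i].

Lemma homog_decomp_ex x : exists d, homog_decomp x d.
Proof.
have [n [c [cg xE]]] := gr_decomp hA x.
exists (n, fun i => if (i < n)%N then c i else 0); split=> /= [i|i|].
- by case: ifP => // _; apply: gr_zero.
- by rewrite ltnNge => ->.
- by rewrite xE; apply: eq_bigr => i _; rewrite ltn_ord.
Qed.

(** The component of degree [i] of [x]; it is independent of the chosen
    decomposition by [hcomp_eq]. *)
Definition hcomp (x : A) : nat -> A := (projT1 (cid (homog_decomp_ex x))).2.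

Lemma hcompP x : exists n, homog_decomp x (n, hcomp x).
Proof. by rewrite /hcomp; case: cid => -[n c] /= H; exists n. Qed.

Lemma sum_widen0 (c : nat -> A) (n N : nat) : (n <= N)%N ->
  (forall i, (n <= i)%N -> c i = 0) -> \sum_(i < n) c i = \sum_(i < N) c i.
Proof.
move=> nN c0; rewrite -!(big_mkord predT c) [RHS](big_cat_nat (n := n)) //=.
rewrite (_ : \sum_(n <= i < N) c i = 0) ?addr0 // big_nat_cond big1 // => i.
by move=> /andP [/andP [ni _] _]; apply: c0.
Qed.

Lemma hcomp_eq x d : homog_decomp x d -> hcomp x =1 d.2.
Proof.
case: d => n c /= [/= cg c0 xE] i; have [m [/= hg h0 xE']] := hcompP x.
pose N := maxn (maxn n m) i.+1.
have nN : (n <= N)%N by rewrite /N !leq_max leqnn.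
have mN : (m <= N)%N by rewrite /N !leq_max leqnn orbT.
have iN : (i < N)%N by rewrite /N leq_max leqnn orbT.
apply/eqP; rewrite -subr_eq0; apply/eqP.
apply: (gr_direct hA (n := N) (c := fun i => hcomp x i - c i)) => //.
  by move=> j; apply: grB.
by rewrite sumrB -(sum_widen0 nN c0) -(sum_widen0 mN h0) -xE -xE' subrr.
Qed.

Lemma hcomp_gr x i : gr i (hcomp x i).
Proof. by have [m [/= hg _ _]] := hcompP x. Qed.

Lemma hcompE x : exists n, x = \sum_(i < n) hcomp x i.
Proof. by have [n [_ _ xE]] := hcompP x; exists n. Qed.

Lemma hcompD x y i : hcomp (x + y) i = hcomp x i + hcomp y i.
Proof.
have [m [/= xg x0 xE]] := hcompP x; have [n [/= yg y0 yE]] := hcompP y.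
apply: (@hcomp_eq _ (maxn m n, fun i => hcomp x i + hcomp y i)); split => /= [j|j|].
- exact: gr_add.
- by rewrite geq_max => /andP [mj nj]; rewrite x0 // y0 // addr0.
- by rewrite {1}xE {1}yE big_split /=; congr (_ + _); apply: sum_widen0 => //;
    rewrite leq_max leqnn ?orbT.
Qed.

Lemma hcomp_homog n x i : gr n x -> hcomp x i = if i == n then x else 0.
Proof.
move=> gx; apply: (@hcomp_eq _ (n.+1, fun i => if i == n then x else 0)); split => /= [j|j|].
- by case: eqP => [->|_] //; apply: gr_zero.
- by rewrite ltn_neqAle eq_sym => /andP [/negPf ->].
- rewrite big_ord_recr /= eqxx big1 ?add0r // => j _.
  by rewrite ltn_eqF.
Qed.

Lemma hcomp0 i : hcomp 0 i = 0.
Proof. by rewrite (@hcomp_homog 0) ?if_same //; apply: gr_zero. Qed.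

Lemma hcomp_sum (T : Type) (r : seq T) (P : pred T) (F : T -> A) i :
  hcomp (\sum_(j <- r | P j) F j) i = \sum_(j <- r | P j) hcomp (F j) i.
Proof. exact: (big_morph (hcomp^~ i) (fun x y => hcompD x y i) (hcomp0 i)). Qed.

Lemma hcompMl p x y i : gr p x ->
  hcomp (x * y) i = if (i < p)%N then 0 else x * hcomp y (i - p).
Proof.
move=> gx; have [n [/= yg y0 yE]] := hcompP y.
apply: (@hcomp_eq _ ((p + n)%N, fun i => if (i < p)%N then 0 else x * hcomp y (i - p))).
split => /= [j|j pj|].
- case: ltnP => [_|pj]; first exact: gr_zero.
  by rewrite -[X in gr X](subnKC pj); apply: gr_mul.
- rewrite ltnNge (leq_trans (leq_addr n p) pj) /= y0 ?mulr0 //.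
  by rewrite leq_subRL // (leq_trans (leq_addr n p) pj).
- rewrite big_split_ord /= big1 ?add0r => [|j _]; last by rewrite ltn_ord.
  rewrite {1}yE mulr_sumr; apply: eq_bigr => j _.
  by rewrite ltnNge leq_addr /= addKn.
Qed.

Lemma hcompM x y i : hcomp (x * y) i = \sum_(j < i.+1) hcomp x j * hcomp y (i - j).
Proof.
have [n [/= xg x0 xE]] := hcompP x.
rewrite {1}xE mulr_suml hcomp_sum.
pose c j := if (i < j)%N then 0 else hcomp x j * hcomp y (i - j).
rewrite (eq_bigr (fun j : 'I_n => c j)) => [|j _]; last by rewrite (@hcompMl j).
rewrite (@sum_widen0 c n (maxn n i.+1)) ?leq_maxl //; last first.
  by move=> j nj; rewrite /c x0 // mul0r if_same.
rewrite -(@sum_widen0 c i.+1) ?leq_maxr //; last by move=> j; rewrite /c => ->.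
by apply: eq_bigr => j _; rewrite /c ltnNge -ltnS ltn_ord.
Qed.

Variables (m : nat) (x : 'I_m -> A).
Hypothesis hx : lin_spans (gr 1%N) x.

(** The elements whose components of positive degree are of this form contain
    [k] and [gr 1] and are stable under sums and products, so they exhaust
    [A]. *)
Lemma gr_succ n y : gr n.+1 y ->
  exists g : 'I_m -> A, (forall j, gr n (g j)) /\ y = \sum_j x j * g j.
Proof.
pose sp n : set A := [set y | exists g : 'I_m -> A, (forall j, gr n (g j)) /\ y = \sum_j x j * g j].
have sp0 l : sp l 0.
  by exists (fun _ => 0); split=> [j|]; [exact: gr_zero|rewrite big1 // => j _; rewrite mulr0].
have spD l u v : sp l u -> sp l v -> sp l (u + v).
  move=> [g [gg ->]] [g' [gg' ->]]; exists (fun j => g j + g' j).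
  by split=> [j|]; [exact: gr_add|rewrite -big_split; apply: eq_bigr => j _; rewrite mulrDr].
have spM l l' u v : sp l u -> gr l' v -> sp (l + l')%N (u * v).
  move=> [g [gg ->]] gv; exists (fun j => g j * v).
  by split=> [j|]; [exact: gr_mul|rewrite mulr_suml; apply: eq_bigr => j _; rewrite mulrA].
pose B : set A := [set y | forall n, sp n (hcomp y n.+1)].
have BT : B = setT.
  apply: (gr_generated hA).
  - by move=> c l; rewrite (hcomp_homog _ (gr0_scalar c)).
  - by move=> u v Bu Bv l; rewrite hcompD; apply: spD.
  - move=> u v Bu Bv l; rewrite hcompM; apply: (big_ind (sp l)) => // [|[[|i] /= il] _].
      exact: spD.
      rewrite subn0; have := hcomp_gr u 0; rewrite (gr_connected hA) => -[c _ <-].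
      by rewrite mulrC; rewrite -[X in sp X](addn0 l); apply: spM; [apply: Bv|apply: gr0_scalar].
    rewrite subSS -[X in sp X](subnKC (il : (i <= l)%N)); apply: spM; first exact: Bu.
    exact: hcomp_gr.
  - move=> u gu l; rewrite (hcomp_homog _ gu); case: eqP => // -[->].
    case: hx => _ /(_ u gu) [c ->]; exists (fun j => (c j)%:A); split=> [j|].
      exact: gr0_scalar.
    by apply: eq_bigr => j _; rewrite mulr_algr.
by move=> gy; have : B y by [rewrite BT]; move=> /(_ n); rewrite (hcomp_homog _ gy) eqxx.
Qed.

Lemma gr_mul_sub p q (K : set A) : is_ideal K ->
  (forall a b, gr p a -> gr q b -> K (a * b)) -> gr (p + q)%N `<=` K.
Proof.
elim: p K => [|p IH] K idK Kab y gy; first by rewrite -[y]mul1r; apply: Kab => //; exact: gr0_1.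
have [g [gg ->]] := gr_succ gy; apply: ideal_sum => // j _.
apply: (IH [set z | K (x j * z)]) => //=; last first.
  move=> a b ga gb; rewrite mulrA; apply: Kab => //; rewrite -add1n; apply: (gr_mul hA) => //.
  by case: hx.
case: idK => K0 KD KM; split=> /=; first by rewrite mulr0.
  by move=> u v Ku Kv; rewrite mulrDr; apply: KD.
by move=> a u Ku; rewrite mulrCA; apply: KM.
Qed.

Lemma gr_ge_sub p q (K : set A) : is_ideal K -> (p <= q)%N -> gr p `<=` K -> gr q `<=` K.
Proof.
move=> idK /subnKC <- pK; apply: gr_mul_sub => // a b ga _.
by apply: idealMr => //; apply: pK.
Qed.

End GradedAlgebra.

(** * Dimension and generic linear forms *)

Section LinearParameters.
Variables (k : closedFieldType) (A : comAlgType k) (gr : nat -> set A).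
Hypothesis hA : standard_graded gr.
Variables (m : nat) (x : 'I_m -> A).
Hypothesis hx : lin_spans (gr 1%N) x.
Variables (h : nat -> nat) (b : forall n, 'I_(h n) -> A).
Hypothesis hb : forall n, lin_basis (gr n) (@b n).

Local Notation hc := (hcomp hA).

(** Homogeneity in terms of components, which is more convenient for Zorn's
    lemma than the existence of homogeneous decompositions. *)
Definition homog_ideal (I : set A) : Prop :=
  is_ideal I /\ forall y i, I y -> I (hc y i).

Definition ideal_plus (I : set A) (t : nat) (z : 'I_t -> A) : set A :=
  [set y | exists u g, I u /\ y = u + \sum_i z i * g i].

Lemma ideal_plus_ideal I t (z : 'I_t -> A) : is_ideal I -> is_ideal (ideal_plus I z).
Proof.
move=> [I0 ID IM]; split.
- by exists 0, (fun _ => 0); rewrite big1 ?addr0 // => i _; rewrite mulr0.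
- move=> _ _ [u [g [Iu ->]]] [v [g' [Iv ->]]]; exists (u + v), (fun i => g i + g' i).
  split; first exact: ID.
  by rewrite addrACA -big_split; congr (_ + _); apply: eq_bigr => i _; rewrite mulrDr.
- move=> a _ [u [g [Iu ->]]]; exists (a * u), (fun i => a * g i); split; first exact: IM.
  by rewrite mulrDr mulr_sumr; congr (_ + _); apply: eq_bigr => i _; rewrite mulrCA.
Qed.

Lemma ideal_plus_sub I t (z : 'I_t -> A) : I `<=` ideal_plus I z.
Proof.
by move=> u Iu; exists u, (fun _ => 0); rewrite big1 ?addr0 // => i _; rewrite mulr0.
Qed.

Lemma ideal_plus_gen I t (z : 'I_t -> A) i : is_ideal I -> ideal_plus I z (z i).
Proof.
move=> [I0 _ _]; exists 0, (fun j => (j == i)%:R); split=> //.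
by rewrite add0r (bigD1 i) //= eqxx mulr1 big1 ?addr0 // => j /negPf ->; rewrite mulr0.
Qed.

Lemma ideal_plus_min (I K : set A) t (z : 'I_t -> A) : is_ideal K -> I `<=` K ->
  (forall i, K (z i)) -> ideal_plus I z `<=` K.
Proof.
move=> idK IK zK _ [u [g [Iu ->]]]; have [_ KD _] := idK.
by apply: KD; [apply: IK|apply: ideal_sum => // i _; apply: idealMr].
Qed.

Lemma ideal_plus_homog I t p (z : 'I_t -> A) :
  homog_ideal I -> (forall i, gr p (z i)) -> homog_ideal (ideal_plus I z).
Proof.
move=> [idI hI] gz; split; first exact: ideal_plus_ideal.
move=> _ i [u [g [Iu ->]]]; rewrite hcompD hcomp_sum.
have [_ KD _] := ideal_plus_ideal z idI.
apply: KD; first by apply: ideal_plus_sub; apply: hI.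
apply: ideal_sum => [|j _]; first exact: ideal_plus_ideal.
rewrite (hcompMl hA _ _ (gz j)); case: ifP => _; first by case: (ideal_plus_ideal z idI).
by apply: idealMr; [exact: ideal_plus_ideal|exact: ideal_plus_gen].
Qed.

(** Take the components of degree [n + 1] of the given expression of [y]. *)
Lemma ideal_plus_hcomp I t (z : 'I_t -> A) n y :
  homog_ideal I -> (forall i, gr 1 (z i)) -> gr n.+1 y -> ideal_plus I z y ->
  exists u g, [/\ I u, forall i, gr n (g i) & y = u + \sum_i z i * g i].
Proof.
move=> [idI hI] gz gy [u [g [Iu yE]]].
exists (hc u n.+1), (fun i => hc (g i) n); split; first exact: hI.
  by move=> i; apply: hcomp_gr.
rewrite -[LHS](_ : hc y n.+1 = y); last by rewrite (hcomp_homog hA _ gy) eqxx.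
rewrite yE hcompD hcomp_sum; congr (_ + _); apply: eq_bigr => i _.
by rewrite (hcompMl hA _ _ (gz i)) ltnS leqn0 subn1.
Qed.

(** Having [gr n.+1] inside [I + (z)] is an open condition on [z].  To stay
    with polynomials in one variable it is tested on the line through [z] and
    [z']: the determinant [p] expresses that the elements obtained by moving
    [z] in fixed expressions of the basis of [gr n.+1] still form a basis, and
    [p] takes the value [1] at [z]. *)
Lemma ideal_plus_generic_line I n t (z z' : 'I_t -> A) :
  homog_ideal I -> (forall i, gr 1 (z i)) -> (forall i, gr 1 (z' i)) ->
  gr n.+1 `<=` ideal_plus I z ->
  exists p : {poly k}, p.[0] != 0 /\ forall c : k, p.[c] != 0 ->
    gr n.+1 `<=` ideal_plus I (fun i => z i + c *: (z' i - z i)).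
Proof.
move=> hI gz gz' cov; have [[bg bspan] _] := hb n.+1.
have /choice [ug ugP] l : exists ug : A * ('I_t -> A),
    [/\ I ug.1, forall i, gr n (ug.2 i) & @b n.+1 l = ug.1 + \sum_i z i * ug.2 i].
  by have [u [g H]] := ideal_plus_hcomp hI gz (bg l) (cov _ (bg l)); exists (u, g).
have /choice [N NP] l : exists N : 'I_(h n.+1) -> k,
    \sum_i (z' i - z i) * (ug l).2 i = \sum_l' N l' *: @b n.+1 l'.
  apply: bspan; apply: (gr_sum hA) => i _; rewrite -add1n; apply: (gr_mul hA).
    exact: (grB hA).
  by case: (ugP l).
pose NM : 'M[k]_(h n.+1) := \matrix_(l, l') N l l'.
exists (\det (1%:M + 'X *: map_mx polyC NM)).
have detE c : (\det (1%:M + 'X *: map_mx polyC NM)).[c] = \det (1%:M + c *: NM).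
  rewrite -[LHS]/(horner_eval c _) -det_map_mx; congr (\det _).
  apply/matrixP => i j; rewrite !mxE /horner_eval.
  rewrite -[LHS]/(((i == j)%:R + 'X * (N i j)%:P).[c]) !hornerE.
  by congr (_ + _); case: eqP => _; rewrite ?mulr1n ?mulr0n ?hornerE.
split; first by rewrite detE scale0r addr0 det1 oner_eq0.
move=> c; rewrite detE => dc0.
set zc := fun i => _; have idI : is_ideal I by case: hI.
have idK := ideal_plus_ideal zc idI; have [K0 KD KM] := idK.
(* Keep the coefficients of the expressions at [z] and move only the forms. *)
have Ke l : ideal_plus I zc (\sum_l' (1%:M + c *: NM) l l' *: @b n.+1 l').
  have -> : \sum_l' (1%:M + c *: NM) l l' *: @b n.+1 l' = (ug l).1 + \sum_i zc i * (ug l).2 i.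
    rewrite (eq_bigr (fun l' => (l == l')%:R *: @b n.+1 l' + c *: (N l l' *: @b n.+1 l'))); last first.
      by move=> l' _; rewrite !mxE scalerDl scalerA.
    rewrite big_split -scaler_sumr -NP (bigD1 l) //= eqxx scale1r big1 ?addr0; last first.
      by move=> l' /negPf ne; rewrite eq_sym ne scale0r.
    have [_ _ ->] := ugP l; rewrite -addrA; congr (_ + _).
    rewrite scaler_sumr -big_split; apply: eq_bigr => i _ /=.
    by rewrite [RHS]mulrDl -scalerAl.
  by exists (ug l).1, (ug l).2; case: (ugP l).
set P := 1%:M + c *: NM in dc0 Ke.
have Kb l : ideal_plus I zc (@b n.+1 l).
  have -> : @b n.+1 l = \sum_l' invmx P l l' *:
      \sum_l'' P l' l'' *: @b n.+1 l''.
    under eq_bigr => l' _ do rewrite scaler_sumr.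
    rewrite exchange_big /= (eq_bigr (fun l'' => (1%:M : 'M[k]_(h n.+1)) l l'' *: @b n.+1 l'')).
      rewrite (bigD1 l) //= mxE eqxx scale1r big1 ?addr0 // => l' /negPf ne.
      by rewrite mxE eq_sym ne scale0r.
    have -> : (1%:M : 'M[k]_(h n.+1)) = invmx P *m P by rewrite mulVmx // unitmxE unitfE.
    move=> l'' _.
    by rewrite [in RHS]mxE scaler_suml; apply: eq_bigr => l' _; rewrite scalerA.
  by apply: ideal_sum => // l' _; rewrite -mulr_algl; apply: KM.
move=> y /bspan [d ->]; apply: ideal_sum => // l _.
by rewrite -mulr_algl; apply: KM.
Qed.

Variable W : set A.
Hypotheses (W1 : W `<=` gr 1) (W0 : W 0).
Hypotheses (WD : forall u v, W u -> W v -> W (u + v)) (WZ : forall (c : k) u, W u -> W (c *: u)).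

(** The ideal [I] plus [t] linear forms of [W] contains a power of the
    irrelevant ideal.  The least such [t] plays the role of the dimension of
    [A / I]. *)
Definition linearly_covered (I : set A) (t : nat) : Prop :=
  exists z : 'I_t -> A, (forall i, W (z i)) /\ exists n, gr n.+1 `<=` ideal_plus I z.

(** The tuples that work for [I], and those that work for [I'], are the
    complement of finitely many points on the line through two suitable
    tuples, and [k] is infinite. *)
Lemma covered_common I I' t : homog_ideal I -> homog_ideal I' ->
  linearly_covered I t -> linearly_covered I' t ->
  exists z : 'I_t -> A, [/\ forall i, W (z i), exists n, gr n.+1 `<=` ideal_plus I z
    & exists n, gr n.+1 `<=` ideal_plus I' z].
Proof.
move=> hI hI' [z [Wz [n cn]]] [z' [Wz' [n' cn']]].
have gz i : gr 1 (z i) by apply: W1.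
have gz' i : gr 1 (z' i) by apply: W1.
have [p [p0 pP]] := ideal_plus_generic_line hI gz gz' cn.
have [q [q0 qP]] := ideal_plus_generic_line hI' gz' gz cn'.
have : p * (q \Po (1 - 'X)) != 0.
  rewrite mulf_neq0 //; first by apply: contra p0 => /eqP ->; rewrite horner0.
  apply: contra q0 => /eqP /(congr1 (fun f : {poly k} => f.[1])).
  by rewrite horner_comp !hornerE subrr => ->.
move=> /closed_nonrootP [c]; rewrite rootE hornerM mulf_eq0 negb_or horner_comp => /andP [pc qc].
exists (fun i => z i + c *: (z' i - z i)); split.
- by move=> i; apply: WD => //; apply: WZ; apply: WD => //; rewrite -scaleN1r; apply: WZ.
- by exists n; apply: pP.
- exists n'; have -> : (fun i => z i + c *: (z' i - z i)) =
      (fun i => z' i + (1 - 'X).[c] *: (z i - z' i)); last exact: qP.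
  apply: funext => i; rewrite !hornerE scalerBl scale1r addrA.
  by rewrite -[in LHS]opprB scalerN (addrC (z' i)) subrK.
Qed.

(** With the same [z] for both ideals, the product of an element of [I + (z) +
    (f)] and one of [I + (z) + (g)] is in [I + (z)] because [f * g] is in [I].
    *)
Lemma covered_mul I t p q f g : homog_ideal I -> gr p f -> gr q g -> I (f * g) ->
  linearly_covered (ideal_plus I (fun _ : 'I_1 => f)) t ->
  linearly_covered (ideal_plus I (fun _ : 'I_1 => g)) t -> linearly_covered I t.
Proof.
move=> hI gf gg Ifg cf cg.
have [z [Wz [n cn] [n' cn']]] := covered_common (ideal_plus_homog hI (fun _ => gf))
  (ideal_plus_homog hI (fun _ => gg)) cf cg.
have idI : is_ideal I by case: hI.
have idK := ideal_plus_ideal z idI; have [K0 KD KM] := idK.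
have split_plus f' y : ideal_plus (ideal_plus I (fun _ : 'I_1 => f')) z y ->
    exists u a, ideal_plus I z u /\ y = u + f' * a.
  move=> [_ [g' [[u [a [Iu ->]]] ->]]]; rewrite big_ord1.
  exists (u + \sum_i z i * g' i), (a 0); split; first by exists u, g'.
  by rewrite addrAC.
exists z; split=> //; exists (n + n'.+1)%N; rewrite -addSn.
apply: (gr_mul_sub hA hx) => // u v /cn /split_plus [u' [a [Ku ->]]].
move=> /cn' /split_plus [v' [a' [Kv ->]]].
have -> : (u' + f * a) * (v' + g * a') = (v' + g * a') * u' + (f * a) * v' + (a * a') * (f * g).
  by ring.
by apply: (KD); [apply: (KD); apply: (KM)|apply: (KM); apply: ideal_plus_sub].
Qed.

(** Being covered involves only finitely many elements of the union, one for
    each element of a basis of [gr n.+1]. *)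
Lemma covered_bigcup (F : set (set A)) t : (forall X, F X -> is_ideal X) ->
  F !=set0 -> total_on F subset ->
  linearly_covered (\bigcup_(X in F) X) t -> exists2 X, F X & linearly_covered X t.
Proof.
move=> Fid [X0 FX0] Ft [z [Wz [n cn]]]; have [[bg bspan] _] := hb n.+1.
have plusS (X Y : set A) y : X `<=` Y -> ideal_plus X z y -> ideal_plus Y z y.
  by move=> XY [v [g' [Xv ->]]]; exists v, g'; split=> //; apply: XY.
have key s : (s <= h n.+1)%N -> exists2 X, F X &
    forall l : 'I_(h n.+1), (l < s)%N -> ideal_plus X z (@b n.+1 l).
  elim: s => [|s IH] sh; first by exists X0.
  have [X FX XP] := IH (ltnW sh).
  have [u [g [[Y FY Yu] bE]]] := cn _ (bg (Ordinal sh)).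
  have YP : ideal_plus Y z (@b n.+1 (Ordinal sh)) by exists u, g.
  have lt_split (l : 'I_(h n.+1)) : (l < s.+1)%N -> (l < s)%N \/ l = Ordinal sh.
    rewrite ltnS leq_eqVlt => /orP [/eqP ls|]; last by left.
    by right; apply: val_inj.
  case: (Ft X Y FX FY) => XY.
    by exists Y => // l /lt_split [/XP|->] //; apply: plusS.
  by exists X => // l /lt_split [/XP|->] //; apply: plusS YP.
have [X FX XP] := key _ (leqnn _); exists X => //; exists z; split=> //; exists n.
have idK := ideal_plus_ideal z (Fid _ FX); have [_ _ KM] := idK.
move=> y /bspan [d ->]; apply: ideal_sum => // l _.
by rewrite -mulr_algl; apply: KM; apply: XP.
Qed.


(** Zorn's lemma, whose chain condition is [covered_bigcup]. *)
Lemma maximal_uncovered I t : homog_ideal I -> ~ linearly_covered I t ->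
  exists P, [/\ homog_ideal P, I `<=` P, ~ linearly_covered P t
    & forall Q, homog_ideal Q -> P `<=` Q -> ~ linearly_covered Q t -> Q `<=` P].
Proof.
move=> hI nI; pose good X := [/\ homog_ideal X, I `<=` X & ~ linearly_covered X t].
(* The empty set is allowed because the empty chain has an empty union. *)
have [F FP Ft|P [PP Pmax]] := @Zorn_bigcup _ (fun X => X = set0 \/ good X).
  have [[X0 [FX0 gX0]]|none] := pselect (exists X, F X /\ good X); last first.
    left; rewrite -subset0 => y [X FX Xy]; case: (FP _ FX) => [E|gX]; first by rewrite -E.
    by case: none; exists X.
  right; pose F' X := F X /\ good X.
  have -> : \bigcup_(X in F) X = \bigcup_(X in F') X.
    apply/seteqP; split=> y [X FX Xy]; last by exists X => //; case: FX.
    exists X => //; split=> //; case: (FP _ FX) => // E.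
    by move: Xy; rewrite E.
  have F't : total_on F' subset by move=> X Y [FX _] [FY _]; apply: Ft.
  have F'id X : F' X -> is_ideal X by move=> [_ [[? _] _ _]].
  split.
  - split; last by move=> y i [X [FX gX] Xy]; exists X => //; case: gX => [[_ hX] _ _]; apply: hX.
    split.
    + by exists X0 => //; case: gX0 => [[[]]].
    + move=> u v [X FX Xu] [Y FY Yv]; have [_ XD _] := F'id _ FX; have [_ YD _] := F'id _ FY.
      case: (F't X Y FX FY) => XY; first by exists Y => //; apply: YD => //; apply: XY.
      by exists X => //; apply: XD => //; apply: XY.
    + by move=> a u [X FX Xu]; exists X => //; case: (F'id _ FX) => _ _; apply.
  - by move=> y Iy; exists X0 => //; case: gX0 => _ + _; apply.
  - move=> /(covered_bigcup F'id) [|//|X [_ [_ _ nX]]]; last by [].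
    by exists X0.
have gI : good I by split.
have gP : good P.
  case: PP => // P0; case: (Pmax I); last by right.
  rewrite P0 properEneq; split; last exact: sub0set.
  by apply/eqP => E; case: hI => [[]]; rewrite -E.
case: gP => hP IP nP; exists P; split=> // Q hQ PQ nQ; apply: contrapT => QP.
case: (Pmax Q); first by split.
by right; split=> //; apply: subset_trans PQ.
Qed.

(** If [u] and [v] are not in [P], consider their components [u_i] and [v_j]
    of least degree outside [P]: modulo [P], the component of degree [i + j]
    of [u * v] is [u_i * v_j]. *)
Lemma homog_prime (P : set A) : homog_ideal P -> ~ P 1 ->
  (forall p q f g, gr p f -> gr q g -> P (f * g) -> P f \/ P g) -> is_prime_ideal P.
Proof.
move=> [idP hP] P1 Ph; split=> // u v Puv; apply: contrapT => /not_orP [Pu Pv].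
have low y : ~ P y -> exists i, ~ P (hc y i) /\ forall j, (j < i)%N -> P (hc y j).
  move=> Py; have ex : exists i, `[< ~ P (hc y i) >].
    apply: contrapT => /forallNP all; apply: Py.
    have [n ->] := hcompE hA y; apply: ideal_sum => // i _.
    by apply: contrapT => Pi; apply: (all i); apply/asboolP.
  exists (ex_minn ex); case: ex_minnP => i /asboolP Pi imin; split=> // j ji.
  by apply: contrapT => Pj; move: ji; rewrite ltnNge imin //; apply/asboolP.
have [i [Pi il]] := low u Pu; have [j [Pj jl]] := low v Pv.
suff : P (hc u i * hc v j).
  by move=> /(Ph _ _ _ _ (hcomp_gr hA u i) (hcomp_gr hA v j)) [].
have := hP _ (i + j)%N Puv; rewrite hcompM.
have iij : (i < (i + j).+1)%N by rewrite ltnS leq_addr.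
rewrite (bigD1 (Ordinal iij)) //= addKn => Ps.
rewrite -[_ * _](addrK (\sum_(l < (i + j).+1 | l != Ordinal iij) hc u l * hc v (i + j - l))).
apply: idealB => //; apply: ideal_sum => // l li.
have [ltl|gel] := ltnP l i; first by apply: idealMr => //; apply: il.
case: (idP) => _ _; apply; apply: jl.
have lti : (i < l)%N.
  by rewrite ltn_neqAle gel andbT; apply: contra li => /eqP il'; apply/eqP/val_inj.
by rewrite ltn_subLR ?ltn_add2r // -ltnS ltn_ord.
Qed.

(** If [f] and [g] were not in [P], both [P + (f)] and [P + (g)] would be
    covered by maximality, hence also [P] by [covered_mul]. *)
Lemma maximal_uncovered_prime P t : homog_ideal P -> ~ linearly_covered P t ->
  (forall Q, homog_ideal Q -> P `<=` Q -> ~ linearly_covered Q t -> Q `<=` P) ->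
  is_prime_ideal P.
Proof.
move=> hP nP Pmax; have [idP _] := hP; apply: homog_prime => //.
  move=> P1; apply: nP; exists (fun _ => 0); split=> //; exists 0%N => y _.
  by apply: ideal_plus_sub; rewrite -[y]mulr1; case: idP => _ _; apply.
move=> p q f g gf gg Pfg; apply: contrapT => /not_orP [Pf Pg]; apply: nP.
have cov e l : gr l e -> ~ P e -> linearly_covered (ideal_plus P (fun _ : 'I_1 => e)) t.
  move=> ge Pe; apply: contrapT => ne; apply: Pe.
  apply: (Pmax _ _ _ ne); last exact: (ideal_plus_gen _ ord0).
    exact: (ideal_plus_homog hP (fun _ => ge)).
  exact: ideal_plus_sub.
exact: (covered_mul hP gf gg Pfg (cov _ _ gf Pf) (cov _ _ gg Pg)).
Qed.

Lemma irrelevant_prime : is_prime_ideal [set u | hc u 0 = 0].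
Proof.
have hM u v : hc (u * v) 0 = hc u 0 * hc v 0 by rewrite hcompM big_ord1.
split=> [|/=|u v /=].
- split=> /= [|u v u0 v0|a u u0]; first exact: hcomp0.
    by rewrite hcompD u0 v0 addr0.
  by rewrite hM u0 mulr0.
- by rewrite (hcomp_homog hA _ (gr0_1 hA)) eqxx; apply/eqP; rewrite oner_eq0.
rewrite hM; have := hcomp_gr hA u 0; have := hcomp_gr hA v 0.
rewrite (gr_connected hA) => -[c _ <-] [e _ <-] /eqP.
rewrite -scalerAl mul1r scalerA scaler_eq0 oner_eq0 orbF mulf_eq0.
by move=> /orP [/eqP ->|/eqP ->]; rewrite scale0r; [left|right].
Qed.

Hypothesis W_cov : exists n, forall K, is_ideal K -> W `<=` K -> gr n.+1 `<=` K.

(** The first prime is a maximal uncovered ideal [P] containing [I].  For a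
    form [l] of [W] outside [P], the ideal [P + (l)] cannot be covered by [t -
    1] forms, so that the induction hypothesis continues the chain; when [t =
    0], the last prime is the irrelevant ideal. *)
Lemma uncovered_prime_chain t I : homog_ideal I -> ~ linearly_covered I t ->
  exists P : nat -> set A, [/\ forall i, (i <= t.+1)%N -> is_prime_ideal (P i),
    forall i, (i < t.+1)%N -> P i `<` P i.+1 & I `<=` P 0%N].
Proof.
elim: t I => [|t IH] I hI nI.
all: have [P [hP IP nP Pmax]] := maximal_uncovered hI nI.
all: have primeP := maximal_uncovered_prime hP nP Pmax.
all: have [idP P1 _] := primeP.
all: have [l [Wl Pl]] : exists l, W l /\ ~ P l by
  (apply: contrapT => /forallNP noL; apply: nP; exists (fun _ => 0); split=> //;
   have [n covn] := W_cov; exists n; apply: (subset_trans (covn P idP _)) => [u Wu|];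
   [by apply: contrapT => Pu; apply: (noL u)|exact: ideal_plus_sub]).
  exists (fun i => if i is 0 then P else [set u | hc u 0 = 0]); split=> // [[|i] _|[|//] _].
  - exact: primeP.
  - exact: irrelevant_prime.
  rewrite properEneq; split.
    apply/eqP => E; apply: Pl; rewrite E /=.
    by rewrite (hcomp_homog hA _ (W1 Wl)).
  move=> u Pu /=; case: hP => _ /(_ u 0%N Pu).
  have := hcomp_gr hA u 0; rewrite (gr_connected hA) => -[c _ <-] Pc.
  have [->|c0] := eqVneq c 0; first by rewrite scale0r.
  case: P1; case: idP => _ _ /(_ c^-1%:A _ Pc).
  by rewrite -scalerAl mul1r scalerA mulVf // scale1r.
have hPl := ideal_plus_homog hP (fun _ : 'I_1 => W1 Wl).
have nPl : ~ linearly_covered (ideal_plus P (fun _ : 'I_1 => l)) t.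
  move=> [z [Wz [n cn]]]; apply: nP.
  exists (fun i => if unlift ord0 i is Some j then z j else l); split.
    by move=> i; case: unlift.
  exists n; apply: (subset_trans cn) => _ [_ [g [[u [a [Pu ->]]] ->]]].
  exists u, (fun i => if unlift ord0 i is Some j then g j else a ord0); split=> //.
  rewrite big_ord1 [in RHS]big_ord_recl unlift_none addrA; congr (_ + _).
  by apply: eq_bigr => i _; rewrite liftK.
have [Q [Qprime Qstrict PQ]] := IH _ hPl nPl.
exists (fun i => if i is i'.+1 then Q i' else P); split=> // [[|i]|[_|i]] //.
- by move=> it; apply: Qprime.
- rewrite properEneq; split.
    apply/eqP => E; apply: Pl; rewrite E; apply: PQ; exact: (ideal_plus_gen (fun _ => l) ord0).
  by apply: subset_trans PQ; apply: ideal_plus_sub.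
by move=> it; apply: Qstrict.
Qed.

(** A chain of primes of length [d + 1] would contradict the dimension. *)
Lemma linear_parameters d : krull_dim_eq A d -> linearly_covered [set 0] d.
Proof.
move=> [_ dmax]; apply: contrapT => /(@uncovered_prime_chain d) [|P [P1 P2 _]].
  split; last by move=> y i ->; apply: hcomp0.
  split=> // [u v -> ->|a u ->]; first by rewrite /= addr0.
  by rewrite /= mulr0.
by have /dmax : has_prime_chain A d.+1; [exists P|rewrite ltnn].
Qed.

End LinearParameters.

(** * Minors, rank and Cramer's rule *)

Lemma ideal_gen_ideal (R : comNzRingType) (S : set R) : is_ideal (ideal_gen S).
Proof.
split=> [I [I0 _ _] _ //|u v Su Sv I idI SI|a u Su I idI SI].
  by case: (idI) => _ ID _; apply: (ID); [apply: Su|apply: Sv].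
by case: (idI) => _ _ IM; apply: (IM); apply: Su.
Qed.

Lemma sub_ideal_gen (R : comNzRingType) (S : set R) : S `<=` ideal_gen S.
Proof. by move=> u Su I _; apply. Qed.

Lemma ideal_gen_sub (R : comNzRingType) (S I : set R) :
  is_ideal I -> S `<=` I -> ideal_gen S `<=` I.
Proof. by move=> idI SI u; apply. Qed.

Lemma rmorph_ker_ideal (R S : comNzRingType) (f : {rmorphism R -> S}) (I : set S) :
  is_ideal I -> is_ideal (f @^-1` I).
Proof.
move=> [I0 ID IM]; split=> /= [|u v Iu Iv|a u Iu]; first by rewrite rmorph0.
  by rewrite rmorphD; apply: ID.
by rewrite rmorphM; apply: IM.
Qed.

(** The increasing enumeration of the image of [f] has the form [f \o s]. *)
Lemma increasing_perm (t p : nat) (f : 'I_t -> 'I_p) : injective f ->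
  exists s : 'S_t, {homo f \o s : i j / (i < j)%N}.
Proof.
move=> finj; pose B : {set 'I_p} := [set f i | i in 'I_t]%SET.
have cB : #|B| = t by rewrite card_imset // card_ord.
pose e (i : 'I_t) := Order.enum_val (cast_ord (esym cB) i).
have /choice [s sP] i : exists j, f j = e i.
  by have /imsetP [j _ ->] : e i \in B := Order.EnumVal.enum_valP _; exists j.
have einj : injective e.
  by move=> i j /Order.EnumVal.enum_val_inj /cast_ord_inj.
have sinj : injective s by move=> i j E; apply: einj; rewrite -!sP E.
exists (perm sinj) => i j ij /=; rewrite !permE !sP.
have : (e i <= e j)%O by rewrite /e Order.EnumVal.le_enum_val; [exact: ltnW|exact: Order.TotalTheory.le_total].
rewrite leEord ltn_neqAle => ->; rewrite andbT; apply: contraTneq ij.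
by move=> /val_inj /einj ->; rewrite ltnn.
Qed.

Lemma det_mxsub_perm (R : comNzRingType) (p q t : nat) (M : 'M[R]_(p, q))
    (f : 'I_t -> 'I_p) (g : 'I_t -> 'I_q) (s u : 'S_t) :
  \det (mxsub (f \o s) (g \o u) M) = (-1) ^+ s * (-1) ^+ u * \det (mxsub f g M).
Proof.
have -> : mxsub (f \o s) (g \o u) M = row_perm s (col_perm u (mxsub f g M)).
  by apply/matrixP => i j; rewrite !mxE.
by rewrite row_permE col_permE !det_mulmx !det_perm odd_permV mulrCA mulrC mulrAC.
Qed.

(** The ideal of minors is generated by increasing index functions; reordering
    rows and columns only changes the sign of a minor. *)
Lemma minor_in_ideal (R : comNzRingType) (p q t : nat) (M : 'M[R]_(p, q))
    (f : 'I_t -> 'I_p) (g : 'I_t -> 'I_q) : injective f -> injective g ->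
  minors_ideal t M (\det (mxsub f g M)).
Proof.
move=> /increasing_perm [s sf] /increasing_perm [u ug].
have -> : \det (mxsub f g M) =
    (-1) ^+ s * (-1) ^+ u * \det (mxsub (f \o s) (g \o u) M).
  by rewrite det_mxsub_perm mulrA mulrACA -!expr2 !sqrr_sign !mul1r.
case: (ideal_gen_ideal [set y | exists (f : 'I_t -> 'I_p) (g : 'I_t -> 'I_q),
    [/\ {homo f : i j / (i < j)%N}, {homo g : i j / (i < j)%N}
      & y = \det (mxsub f g M)]]) => _ _; apply.
by apply: sub_ideal_gen; exists (f \o s), (g \o u).
Qed.

Lemma rank_mxsub (F : fieldType) (p q t u : nat) (M : 'M[F]_(p, q))
    (f : 'I_t -> 'I_p) (g : 'I_u -> 'I_q) : (\rank (mxsub f g M) <= \rank M)%N.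
Proof.
rewrite mxsubrc (leq_trans (mxrankS (rowsub_sub _ _))) //.
rewrite -mxrank_tr trmx_mxsub.
by rewrite (leq_trans (mxrankS (rowsub_sub _ _))) // mxrank_tr.
Qed.

Lemma row_free_rowsub (F : fieldType) (p q t : nat) (B : 'M[F]_(p, q)) (f : 'I_t -> 'I_p) :
  injective f -> row_free B -> row_free (rowsub f B).
Proof.
move=> finj /row_freeP [C BC]; apply/row_freeP; exists (colsub f C).
rewrite -mxsub_mul BC; apply/matrixP => i j.
by rewrite !mxE (inj_eq finj).
Qed.

(** If the rank is at least [t], choose [t] independent rows, and then [t]
    independent columns among those of the selected rows. *)
Lemma minors_vanish_rank (R : comNzRingType) (F : fieldType) (ev : {rmorphism R -> F})
    (p q t : nat) (M : 'M[R]_(p, q)) :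
  (forall y, minors_ideal t M y -> ev y = 0) <-> (\rank (map_mx ev M) < t)%N.
Proof.
split=> [vanish|rk].
  rewrite ltnNge; apply/negP => tr.
  pose f (i : 'I_t) := maxrankfun (map_mx ev M) (widen_ord tr i).
  have finj : injective f.
    by move=> i j /maxrankfun_inj /(congr1 val) /= ij; apply: val_inj.
  have fullf : row_full (rowsub f (map_mx ev M))^T.
    rewrite /row_full mxrank_tr -/(row_free _).
    have := maxrowsub_free (map_mx ev M); set B := rowsub _ _ => freeB.
    have -> : rowsub f (map_mx ev M) = rowsub (widen_ord tr) B.
      by apply/matrixP => i j; rewrite !mxE.
    by apply: row_free_rowsub => // i j /(congr1 val) ij; apply: val_inj.
  have := fullrowsub_unit fullf; set g := fullrankfun _ => ug.
  have ginj : injective g by apply: fullrankfun_inj.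
  have := vanish _ (minor_in_ideal finj ginj).
  rewrite -det_map_mx map_mxsub => d0; move: ug.
  rewrite unitmxE unitfE -det_tr => /negP; apply; apply/eqP; rewrite -[RHS]d0.
  by congr (\det _); apply/matrixP => i j; rewrite !mxE.
move=> y; apply: (ideal_gen_sub (I := ev @^-1` [set 0])).
  apply: rmorph_ker_ideal; split=> [//|u v -> ->|a u ->]; first by rewrite /= addr0.
  by rewrite /= mulr0.
move=> _ [f [g [_ _ ->]]] /=; apply: contraTeq rk => d0.
rewrite -leqNgt -[X in (X <= _)%N](_ : \rank (mxsub f g (map_mx ev M)) = t) ?rank_mxsub //.
by apply: mxrank_unit; rewrite unitmxE unitfE -map_mxsub det_map_mx.
Qed.

(** Multiply the bordered matrix on the left by the block matrix with rows
    [(\adj S, 0)] and [(- v \adj S, \det S)] to make it block triangular.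
    Both determinants acquire the factor [\det S ^ t], which is cancelled. *)
Lemma det_bordered (R : idomainType) (t : nat) (S : 'M[R]_t) (u : 'cV[R]_t)
    (v : 'rV[R]_t) (c : 'M[R]_1) : \det S != 0 ->
  \det (block_mx S u v c) = \det S * c 0 0 - (v *m \adj S *m u) 0 0.
Proof.
move=> S0; apply: (mulfI (expf_neq0 t S0)).
have detS : \det (\adj S) * \det S = \det S ^+ t.
  by rewrite -det_mulmx mul_adj_mx det_scalar.
have E : block_mx (\adj S) 0 (- (v *m \adj S)) (\det S)%:M *m block_mx S u v c =
    block_mx (\det S)%:M (\adj S *m u) 0 (\det S *: c - v *m \adj S *m u).
  rewrite mulmx_block mul_adj_mx !mul0mx !addr0 !mul_scalar_mx !mulNmx -(mulmxA v _ S).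
  by rewrite mul_adj_mx mul_mx_scalar addNr (addrC (- _)).
have := congr1 determinant E.
by rewrite det_mulmx det_lblock det_ublock !det_scalar expr1 detS det_mx11 !mxE.
Qed.

(** Cramer's rule in excess: up to a multiple of the determinant, the defect
    of [w] from being the combination of the rows [f] that agrees with [w] on
    the columns [g]. *)
Definition cramer_residue (R : comNzRingType) (p q t : nat) (M : 'M[R]_(p, q))
    (f : 'I_t -> 'I_p) (g : 'I_t -> 'I_q) (w : 'rV[R]_q) : 'rV[R]_q :=
  \det (mxsub f g M) *: w - colsub g w *m \adj (mxsub f g M) *m rowsub f M.

Lemma cramer_residue_pivot (R : comNzRingType) (p q t : nat) (M : 'M[R]_(p, q))
    (f : 'I_t -> 'I_p) (g : 'I_t -> 'I_q) (w : 'rV[R]_q) i :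
  cramer_residue M f g w 0 (g i) = 0.
Proof.
suff E : colsub g (cramer_residue M f g w) = 0.
  by have := congr1 (fun N : 'rV[R]_t => N 0 i) E; rewrite !mxE.
rewrite /cramer_residue linearB linearZ /= -mulmx_colsub -mxsubcr -mulmxA mul_adj_mx.
by rewrite mul_mx_scalar subrr.
Qed.

(** By [det_bordered], the entry of index [c] is the minor of the matrix [M]
    extended by the row [w], on the rows [f] and the last one and on the
    columns [g] and [c].  The extended matrix has rank at most [t] after
    specialization. *)
Lemma cramer_residue_specialize (R : idomainType) (F : fieldType) (ev : {rmorphism R -> F})
    (p q t : nat) (M : 'M[R]_(p, q)) (f : 'I_t -> 'I_p) (g : 'I_t -> 'I_q) (w : 'rV[R]_q) c :
  \det (mxsub f g M) != 0 -> (map_mx ev w <= map_mx ev M)%MS ->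
  (\rank (map_mx ev M) <= t)%N -> ev (cramer_residue M f g w 0 c) = 0.
Proof.
move=> S0 wM rk.
(* The rows [f] followed by [w], and the columns [g] followed by [c]. *)
pose f' (i : 'I_(t + 1)) : 'I_(p + 1) :=
  match split i with inl j => lshift 1 (f j) | inr j => rshift p j end.
pose g' (i : 'I_(t + 1)) : 'I_q := match split i with inl j => g j | inr j => c end.
have -> : cramer_residue M f g w 0 c = \det (mxsub f' g' (col_mx M w)).
  have -> : mxsub f' g' (col_mx M w) =
      block_mx (mxsub f g M) (rowsub f (col c M)) (colsub g w) (col c w).
    have f'l i : f' (lshift 1 i) = lshift 1 (f i) by rewrite /f' (unsplitK (inl _)).
    have f'r i : f' (rshift t i) = rshift p i by rewrite /f' (unsplitK (inr _)).
    have g'l i : g' (lshift 1 i) = g i by rewrite /g' (unsplitK (inl _)).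
    have g'r (i : 'I_1) : g' (rshift t i) = c by rewrite /g' (unsplitK (inr _)).
    apply/matrixP => i j; rewrite -(splitK i) -(splitK j) [LHS]mxE.
    case: (split i) => i'; case: (split j) => j' /=.
    - by rewrite block_mxEul f'l g'l col_mxEu mxE.
    - by rewrite block_mxEur f'l g'r col_mxEu !mxE.
    - by rewrite block_mxEdl f'r g'l col_mxEd mxE.
    - by rewrite block_mxEdr f'r g'r col_mxEd mxE.
  rewrite det_bordered // !mxE; congr (_ - _); apply: eq_bigr => i _.
  by rewrite !mxE.
rewrite -det_map_mx map_mxsub map_col_mx; apply/eqP; apply: contraTT rk => d0.
rewrite -ltnNge -[X in (X <= _)%N](_ : \rank (mxsub f' g' (col_mx (map_mx ev M) (map_mx ev w))) = t.+1).
  rewrite (leq_trans (rank_mxsub _ _ _)) // mxrankS // col_mx_sub submx_refl.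
  exact: wM.
by rewrite -[RHS]addn1; apply: mxrank_unit; rewrite unitmxE unitfE.
Qed.

(** * Specialization of the generic linear forms *)

Section Specialization.
Variables (k : closedFieldType) (A : comAlgType k) (gr : nat -> set A).
Hypothesis hA : standard_graded gr.
Variables (d m : nat) (x : 'I_m -> A).
Hypothesis hx : lin_spans (gr 1%N) x.
Variables (h : nat -> nat) (b : forall n, 'I_(h n) -> A).
Hypothesis hb : forall n, lin_basis (gr n) (@b n).
Variable M : forall n, 'M[{mpoly k[d * m]}]_(d * h n.-1, h n).
Hypothesis hM : forall n, (1 <= n)%N -> is_coef_matrix x (@b n.-1) (@b n) (M n).

Definition special_form (a : 'M[k]_(d, m)) (i : 'I_d) : A := \sum_j a i j *: x j.

Definition special_ideal (a : 'M[k]_(d, m)) : set A := ideal_gen (range (special_form a)).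

Definition special_mx (n : nat) (a : 'M[k]_(d, m)) : 'M[k]_(d * h n.-1, h n) :=
  map_mx (meval (mxvec a 0)) (M n).

Definition special_eval (a : 'M[k]_(d, m)) : {mpoly A[d * m]} -> A :=
  meval (fun i => (mxvec a 0 i)%:A).

Lemma special_evalM a : {morph special_eval a : u v / u * v}.
Proof. exact: mevalM. Qed.

Lemma special_evalD a : {morph special_eval a : u v / u + v}.
Proof. exact: mevalD. Qed.

Lemma special_evalC a c : special_eval a c%:MP = c.
Proof. exact: mevalC. Qed.

Lemma special_eval_form a i : special_eval a (gen_form x i) = special_form a i.
Proof.
rewrite /special_eval raddf_sum; apply: eq_bigr => j _ /=.
by rewrite mevalM /gen_var mevalXU mevalC mxvecE mulr_algl.
Qed.

Lemma special_eval_lift a F : special_eval a (lift_poly A F) = (F.@[mxvec a 0])%:A.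
Proof.
transitivity (mmap (in_alg A) (fun i => (mxvec a 0 i)%:A) F).
  by apply: rmorph_mmap => [c|i]; [apply: mevalC|apply: mevalXU].
by apply/esym; apply: (@rmorph_mmap _ _ _ _ (in_alg A) idfun (fun i => mxvec a 0 i)).
Qed.

Lemma special_form_gr a i : gr 1 (special_form a i).
Proof. by apply: (gr_sum hA) => j _; apply: (gr_scale hA); case: hx. Qed.

Lemma special_form_scale c a i : special_form (c *: a) i = c *: special_form a i.
Proof. by rewrite scaler_sumr; apply: eq_bigr => j _; rewrite mxE scalerA. Qed.

Lemma special_mxP n a i j : special_form a i * @b n j =
  \sum_l special_mx n.+1 a (mxvec_index i j) l *: @b n.+1 l.
Proof.
have := congr1 (special_eval a) (hM (ltn0Sn n) i j).
rewrite special_evalM special_evalC special_eval_form => ->.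
rewrite /special_eval raddf_sum; apply: eq_bigr => l _.
rewrite -[LHS]/(special_eval a _) special_evalM special_evalC special_eval_lift.
by rewrite mulr_algl !mxE.
Qed.

Lemma basis_inj n (u v : 'rV[k]_(h n)) :
  \sum_l u 0 l *: @b n l = \sum_l v 0 l *: @b n l -> u = v.
Proof.
move=> E; apply/rowP => l; apply/eqP; rewrite -subr_eq0; apply/eqP.
case: (hb n) => _ /(_ (fun l => u 0 l - v 0 l)); apply.
by rewrite (eq_bigr _ (fun l _ => scalerBl _ _ _)) sumrB E subrr.
Qed.

Lemma basis_coord n w : gr n w -> exists u : 'rV[k]_(h n), w = \sum_l u 0 l *: @b n l.
Proof.
move=> gw; have [[_ /(_ w gw) [c ->]] _] := hb n.
by exists (\row_l c l); apply: eq_bigr => l _; rewrite mxE.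
Qed.

Lemma special_idealE a : special_ideal a = ideal_plus [set 0] (special_form a).
Proof.
have id0 : is_ideal [set 0 : A].
  by split=> // [u v -> ->|c u ->]; rewrite /= ?addr0 ?mulr0.
apply/seteqP; split.
  apply: ideal_gen_sub; first exact: ideal_plus_ideal.
  by move=> _ [i _ <-]; apply: ideal_plus_gen.
apply: ideal_plus_min; first exact: ideal_gen_ideal.
  by move=> _ ->; case: (ideal_gen_ideal (range (special_form a))).
by move=> i; apply: sub_ideal_gen; exists i.
Qed.

Lemma sum_mxvec_index (V : nmodType) p q (F : 'I_(p * q) -> V) :
  \sum_r F r = \sum_(i < p) \sum_(j < q) F (mxvec_index i j).
Proof.
rewrite pair_big (reindex _ (curry_mxvec_bij _ _)) /=.
by apply: eq_bigr => -[i j].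
Qed.

Lemma special_mx_comb n a (e : 'I_d -> 'I_(h n) -> k) :
  \sum_i \sum_j e i j *: (special_form a i * @b n j) =
  \sum_l (mxvec (\matrix_(i, j) e i j) *m special_mx n.+1 a) 0 l *: @b n.+1 l.
Proof.
under [RHS]eq_bigr => l _ do rewrite mxE scaler_suml sum_mxvec_index.
rewrite [RHS]exchange_big; apply: eq_bigr => i _ /=; rewrite [RHS]exchange_big.
apply: eq_bigr => j _ /=; rewrite special_mxP scaler_sumr.
by apply: eq_bigr => l _; rewrite scalerA mxvecE mxE.
Qed.

(** An element of degree [n + 1] of the ideal is a combination of the special
    forms with coefficients in [gr n], that is, a combination of the products
    of these forms with the basis of [gr n]; the coordinates of these products
    are the rows of the specialized matrix. *)
Lemma special_ideal_coord n a (u : 'rV[k]_(h n.+1)) :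
  special_ideal a (\sum_l u 0 l *: @b n.+1 l) <-> (u <= special_mx n.+1 a)%MS.
Proof.
have [_ QD QM] := ideal_gen_ideal (range (special_form a)).
split=> [|/submxP [e ->]].
  rewrite special_idealE => Qu.
  have id0 : homog_ideal hA [set 0].
    split; last by move=> y i ->; apply: hcomp0.
    by split=> // [v w -> ->|c v ->]; rewrite /= ?addr0 ?mulr0.
  have gu : gr n.+1 (\sum_l u 0 l *: @b n.+1 l).
    by apply: (gr_sum hA) => l _; apply: (gr_scale hA); case: (hb n.+1) => -[].
  have [_ [g [-> gg]]] := ideal_plus_hcomp id0 (special_form_gr a) gu Qu.
  rewrite add0r => E.
  have /choice [e eP] i : exists e : 'rV[k]_(h n), g i = \sum_j e 0 j *: @b n j.
    exact: basis_coord.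
  apply/submxP; exists (mxvec (\matrix_(i, j) e i 0 j)); apply: basis_inj.
  rewrite E -special_mx_comb; apply: eq_bigr => i _; rewrite eP mulr_sumr.
  by apply: eq_bigr => j _; rewrite scalerAr.
rewrite -(vec_mxK e); set N := vec_mx e.
have -> : N = \matrix_(i, j) N i j by apply/matrixP => i j; rewrite mxE.
have idQ : is_ideal (special_ideal a) by exact: ideal_gen_ideal.
rewrite -special_mx_comb; apply: (ideal_sum _ idQ) => i _; apply: (ideal_sum _ idQ) => j _.
rewrite -mulr_algl; apply: QM; apply: (idealMr _ idQ).
by apply: sub_ideal_gen; exists i.
Qed.

(** Both sides say that the rows of the specialized matrix span the
    coordinates of all elements of [gr n.+1]. *)
Lemma special_mx_full n a :
  (\rank (special_mx n.+1 a) = h n.+1) <-> gr n.+1 `<=` special_ideal a.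
Proof.
split=> [/eqP full w /basis_coord [u ->]|sub].
  by apply/special_ideal_coord; apply: submx_full.
apply/eqP; rewrite -[_ == _]/(row_full _) -sub1mx; apply/row_subP => l.
apply/special_ideal_coord; rewrite (bigD1 l) //= !mxE eqxx scale1r big1 ?addr0.
  by apply: sub; case: (hb n.+1) => -[].
by move=> l' /negPf ne; rewrite !mxE eq_sym ne scale0r.
Qed.

Lemma special_mx_scale n c a : special_mx n.+1 (c *: a) = c *: special_mx n.+1 a.
Proof.
apply/row_matrixP => r; case/mxvec_indexP: r => i j; apply: basis_inj.
rewrite [LHS](eq_bigr (fun l => special_mx n.+1 (c *: a) (mxvec_index i j) l *: @b n.+1 l)).
  rewrite -special_mxP special_form_scale -scalerAl special_mxP scaler_sumr.
  by apply: eq_bigr => l _; rewrite !mxE scalerA.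
by move=> l _; rewrite !mxE.
Qed.

Lemma special_minors n t (a : 'M[k]_(d, m)) :
  (forall F, minors_ideal t (M n) F -> F.@[mxvec a 0] = 0) <->
  (\rank (special_mx n a) < t)%N.
Proof. exact: minors_vanish_rank. Qed.

Lemma rank_locusP n t (L : proj_space 'M[k]_(d, m)) :
  rank_locus M n t L <->
  (forall a, a \in sval L -> a != 0 -> (\rank (special_mx n a) < t)%N).
Proof.
by split=> H a aL a0; [apply/special_minors; apply: H|apply/special_minors; apply: H].
Qed.

Lemma line_mem (a : 'M[k]_(d, m)) : a != 0 ->
  exists L : proj_space 'M[k]_(d, m), a \in sval L.
Proof.
move=> a0; have dimL : \dim <[a]>%VS == 1%N by rewrite dim_vline a0.
by exists (exist _ <[a]>%VS dimL); apply: memv_line.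
Qed.

Lemma line_scale (L : proj_space 'M[k]_(d, m)) a a' : a \in sval L -> a != 0 ->
  a' \in sval L -> exists c, a' = c *: a.
Proof.
case: L => L /= dimL aL a0 a'L.
have : (<[a]> == L)%VS by rewrite eqEdim (eqP dimL) dim_vline a0 -memvE aL.
by move=> /eqP E; move: a'L; rewrite -E => /vlineP.
Qed.

End Specialization.

(** * The formula for the core *)

Lemma ideal_add_ideal (R : comNzRingType) (I J : set R) :
  is_ideal I -> is_ideal J -> is_ideal (ideal_add I J).
Proof.
move=> [I0 ID IM] [J0 JD JM]; split.
- by exists 0, 0; rewrite addr0.
- move=> _ _ [y [z [Iy Jz ->]]] [y' [z' [Iy' Jz' ->]]]; exists (y + y'), (z + z').
  by rewrite addrACA; split=> //; [apply: ID|apply: JD].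
- move=> a _ [y [z [Iy Jz ->]]]; exists (a * y), (a * z).
  by rewrite mulrDr; split=> //; [apply: IM|apply: JM].
Qed.

Lemma ideal_colon_ideal (R : comNzRingType) (K S : set R) :
  is_ideal K -> is_ideal (ideal_colon K S).
Proof.
move=> [K0 KD KM]; split=> [y _|u v Ku Kv y Sy|a u Ku y Sy]; first by rewrite mul0r.
  by rewrite mulrDl; apply: KD; [apply: Ku|apply: Kv].
by rewrite -mulrA; apply: KM; apply: Ku.
Qed.

Lemma radical0 (R : comNzRingType) (I : set R) : is_ideal I -> radical I 0.
Proof. by case=> I0 _ _; exists 1%N; rewrite expr1. Qed.

Section BigIdeals.
Variables (R : comNzRingType) (T : eqType) (I : T -> set R).

Lemma sub_big_ideal_add (s : seq T) j : (forall i, I i 0) -> j \in s ->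
  I j `<=` \big[@ideal_add _/[set 0]]_(i <- s) I i.
Proof.
move=> I0; have big0 (s' : seq T) : (\big[@ideal_add _/[set 0]]_(i <- s') I i) 0.
  elim: s' => [|i s' IH]; first by rewrite big_nil.
  by rewrite big_cons; exists 0, 0; rewrite addr0.
elim: s => // i s IH; rewrite inE big_cons => /orP [/eqP -> u Iu|/IH js u /js Iu].
  by exists u, 0; rewrite addr0.
by exists 0, u; rewrite add0r.
Qed.

Lemma big_ideal_add_sub (s : seq T) (K : set R) : is_ideal K -> (forall i, I i `<=` K) ->
  \big[@ideal_add _/[set 0]]_(i <- s) I i `<=` K.
Proof.
move=> [K0 KD _] IK; elim: s => [|i s IH]; first by rewrite big_nil => u ->.
by rewrite big_cons => _ [y [z [Iy Iz ->]]]; apply: KD; [apply: IK Iy|apply: IH].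
Qed.

Lemma big_ideal_mul_sub (s : seq T) j : (forall i, is_ideal (I i)) -> j \in s ->
  \big[@ideal_mul _/setT]_(i <- s) I i `<=` I j.
Proof.
move=> idI; elim: s => // i s IH; rewrite inE big_cons => js.
apply: ideal_gen_sub; first exact: idI.
move=> _ [y [z [Iy Iz ->]]]; case/orP: js => [/eqP ->|js]; first exact: idealMr.
by case: (idI j) => _ _; apply; apply: IH.
Qed.

Lemma big_ideal_mul_prod (s : seq T) (F : T -> R) : (forall i, I i (F i)) ->
  (\big[@ideal_mul _/setT]_(i <- s) I i) (\prod_(i <- s) F i).
Proof.
move=> IF; elim: s => [|i s IH]; first by rewrite !big_nil.
by rewrite !big_cons; apply: sub_ideal_gen; exists (F i), (\prod_(i <- s) F i).
Qed.
End BigIdeals.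

Section Core.
Variables (k : closedFieldType) (A : comAlgType k) (gr : nat -> set A).
Hypothesis hA : standard_graded gr.
Variables (d m r : nat) (x : 'I_m -> A).
Hypothesis hx : lin_spans (gr 1%N) x.
Variables (h : nat -> nat) (b : forall n, 'I_(h n) -> A).
Hypothesis hb : forall n, lin_basis (gr n) (@b n).
Variable M : forall n, 'M[{mpoly k[d * m]}]_(d * h n.-1, h n).
Hypothesis hM : forall n, (1 <= n)%N -> is_coef_matrix x (@b n.-1) (@b n) (M n).
Hypotheses (hd : krull_dim_eq A d) (d_ge1 : (1 <= d)%N) (hr : is_last_jump M r).

Local Notation hc := (hcomp hA).
Local Notation Qa := (special_ideal x).
Local Notation Ma := (special_mx M).
Let good (a : 'M[k]_(d, m)) := \rank (Ma r.+1 a) = h r.+1.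

Lemma special_ideal_ideal (a : 'M[k]_(d, m)) : is_ideal (Qa a).
Proof. exact: ideal_gen_ideal. Qed.

(** If [gr n] is zero then every element of [gr 1] is nilpotent, so that every
    prime contains the irrelevant ideal, which is maximal, and there is no
    chain of length [1]. *)
Lemma gr_nonzero n : ~ (gr n `<=` [set 0]).
Proof.
move=> gn0; have [[P [Pprime Pstrict]] _] := hd.
have [[P00 P0D P0M] P01 P0mul] := Pprime 0%N isT.
have [idP1 P11 _] := Pprime 1%N d_ge1; have [_ _ P1M] := idP1.
have idP0 : is_ideal (P 0%N) by split.
have gr1P : gr 1 `<=` P 0%N.
  move=> u gu; have : P 0%N (u ^+ n).
    have -> : u ^+ n = 0; last by [].
    apply: gn0; elim: n => [|n IH]; first exact: gr0_1.
    by rewrite exprS -add1n; apply: (gr_mul hA).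
  by elim: n {gn0} => [/P01//|n IH]; rewrite exprS => /P0mul [|/IH].
have grP i : gr i.+1 `<=` P 0%N by apply: (gr_ge_sub hA hx idP0 _ gr1P).
have := Pstrict 0%N d_ge1; rewrite properEneq => -[/eqP ne sub]; apply: ne.
apply/seteqP; split=> // z P1z; have [[|n'] zE] := hcompE hA z.
  by rewrite zE big_ord0.
have restP : P 0%N (\sum_(i < n') hc z i.+1).
  by apply: ideal_sum => // i _; apply: (grP i); apply: hcomp_gr.
move: zE; rewrite big_ord_recl => zE.
have : P 1%N (hc z 0).
  have -> : hc z 0 = z - \sum_(i < n') hc z i.+1 by rewrite [X in X - _]zE addrK.
  by apply: idealB => //; apply: sub.
have := hcomp_gr hA z 0; rewrite (gr_connected hA) => -[c _ cE].
rewrite -cE => P1c; have c0 : c = 0.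
  apply: contrapT => /eqP c0; apply: P11; have := P1M c^-1%:A _ P1c.
  by rewrite -scalerAl mul1r scalerA mulVf // scale1r.
by rewrite zE -cE c0 scale0r add0r.
Qed.

(** There is no jump after [r]. *)
Lemma full_locus_stable n : full_locus M r.+1 = full_locus M (r.+1 + n)%N.
Proof.
elim: n => [|n ->]; first by rewrite addn0.
rewrite addnS; apply: contrapT => /(proj2 hr); apply/negP.
by rewrite -ltnNge ltnS leq_addr.
Qed.

Lemma full_locusP n (L : proj_space 'M[k]_(d, m)) : full_locus M n.+1 L <->
  forall a, a \in sval L -> a != 0 -> ~ gr n.+1 `<=` Qa a.
Proof.
rewrite /full_locus rank_locusP; split=> H a aL a0.
  move=> /(special_mx_full hA hx hb hM) E.
  by have := H a aL a0; rewrite E ltnn.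
rewrite ltn_neqAle rank_leq_col andbT; apply/eqP => /(special_mx_full hA hx hb hM).
exact: H.
Qed.

(** Otherwise [V_(r+1)] is the whole space, and so is [V_r], which contains
    it. *)
Lemma exists_good : exists (L : proj_space 'M[k]_(d, m)) (a : 'M[k]_(d, m)), [/\ a \in sval L, a != 0 & good a].
Proof.
apply: contrapT => none; apply: (proj1 hr).
have all L : full_locus M r.+1 L.
  apply/full_locusP => a aL a0 /(special_mx_full hA hx hb hM) ga; apply: none.
  by exists L, a.
apply/seteqP; split=> // L _; case: (r) all => // r' all.
apply/full_locusP => a aL a0 sub; have /full_locusP/(_ a aL a0) := all L; apply.
exact: (gr_ge_sub hA hx (special_ideal_ideal a) (leqnSn r'.+1) sub).
Qed.

Lemma special_ideal_homog (a : 'M[k]_(d, m)) : homog_ideal hA (Qa a).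
Proof.
rewrite special_idealE; apply: (ideal_plus_homog (p := 1)); last exact: special_form_gr.
split; last by move=> y i ->; apply: hcomp0.
by split=> // [u v -> ->|c u ->]; rewrite /= ?addr0 ?mulr0.
Qed.

Lemma core_sub_good a : good a -> core gr `<=` Qa a.
Proof.
move=> /(special_mx_full hA hx hb hM) sub z; apply.
have [idQ hQ] := special_ideal_homog a; split.
- split=> // y Qy; have [n yE] := hcompE hA y; exists n, (hc y); split=> // i.
  by split; [apply: hcomp_gr|apply: hQ].
- by exists (range (special_form x a)) => // _ [i _ <-]; apply: special_form_gr.
- by exists r.+1 => n rn; apply: (gr_ge_sub hA hx idQ rn sub).
Qed.

(** Every reduction [Q] contains the ideal of a good matrix.  The matrix [a]
    built from [d] linear forms of [Q] may only be known to generate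
    everything in a high degree; stability of the loci shows that a multiple
    [a'] of [a] is good. *)
Lemma good_sub_core z : (forall a, a != 0 -> good a -> Qa a z) -> core gr z.
Proof.
move=> zQ Q [[idQ _] [L LW QE] [n0 n0Q]]; have [Q0 QD QM] := idQ.
pose W := Q `&` gr 1.
have [y [Wy [n1 cov]]] : linearly_covered gr W [set 0] d.
  apply: (linear_parameters hA hx hb) => //.
  - by move=> u [].
  - by split; [|apply: gr_zero].
  - by move=> u v [Qu gu] [Qv gv]; split; [apply: QD|apply: (gr_add hA)].
  - move=> c u [Qu gu]; split; [rewrite -mulr_algl; exact: QM|exact: (gr_scale hA)].
  - exists n0 => K idK WK; apply: (subset_trans (n0Q _ (leqnSn n0))).
    rewrite QE; apply: ideal_gen_sub => // l Ll; apply: WK; split; last exact: LW.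
    by rewrite QE; apply: sub_ideal_gen.
have /choice [al alP] i : exists c : 'I_m -> k, y i = \sum_j c j *: x j.
  by case: hx => _; apply; case: (Wy i).
pose a : 'M[k]_(d, m) := \matrix_(i, j) al i j.
have ya : special_form x a = y.
  by apply: funext => i; rewrite alP; apply: eq_bigr => j _; rewrite mxE.
have cova : gr n1.+1 `<=` Qa a by rewrite special_idealE ya.
have a0 : a != 0.
  apply/eqP => a0; apply: (@gr_nonzero n1.+1); apply: (subset_trans cova).
  apply: ideal_gen_sub.
    by split=> // [u v -> ->|c u ->]; rewrite /= ?addr0 ?mulr0.
  move=> _ [i _ <-] /=; rewrite /special_form big1 // => j _.
  by rewrite a0 mxE scale0r.
have [L' aL] := line_mem a0.
have nL : ~ full_locus M r.+1 L'.
  rewrite (full_locus_stable n1) addSn => /full_locusP /(_ a aL a0); apply.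
  apply: (gr_ge_sub hA hx (special_ideal_ideal a) _ cova).
  by rewrite ltnS leq_addl.
have [a' [a'L a'0 ga']] : exists a', [/\ a' \in sval L', a' != 0 & good a'].
  apply: contrapT => none; apply: nL; apply/full_locusP => a' a'L a'0.
  by move=> /(special_mx_full hA hx hb hM) ga; apply: none; exists a'.
apply: (ideal_gen_sub idQ _ (zQ a' a'0 ga')) => _ [i _ <-].
have [c ->] := line_scale aL a0 a'L; rewrite special_form_scale ya -mulr_algl.
by apply: QM; case: (Wy i).
Qed.

Lemma core_hcomp z n : core gr z -> core gr (hc z n).
Proof.
move=> cz Q redQ; have [[[Q0 _ _] Qdec] _ _] := redQ.
have [l [c [cQ zE]]] := Qdec z (cz Q redQ).
rewrite zE hcomp_sum; apply: ideal_sum => [|i _]; first by case: redQ => -[].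
have [gc Qc] := cQ i; rewrite (hcomp_homog hA _ gc); case: ifP => // _.
Qed.

Lemma core_degree0 z : core gr z -> gr 0 z -> z = 0.
Proof.
move=> cz gz; have [L [a [aL a0 ga]]] := exists_good.
have : [set u | hc u 0 = 0] z.
  apply: (ideal_gen_sub _ _ (core_sub_good ga cz)).
    by case: (irrelevant_prime hA).
  move=> _ [i _ <-] /=; rewrite (hcomp_homog hA _ (special_form_gr hA hx a i)) //.
by rewrite /= (hcomp_homog hA _ gz).
Qed.


Section Bracket.
Variable a : r.-tuple nat.

Let K : set {mpoly A[d * m]} :=
  ideal_add (gen_ideal d x) (ideal_ext A (radical_sum M a)).

Lemma bracket_ideal : is_ideal K.
Proof. by apply: ideal_add_ideal; apply: ideal_gen_ideal. Qed.

Lemma gen_ideal_bracket : gen_ideal d x `<=` K.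
Proof.
move=> u Qu; exists u, 0; rewrite addr0; split=> //.
by case: (ideal_gen_ideal (@lift_poly k A d m @` radical_sum M a)).
Qed.

Lemma radical_bracket (i : 'I_r) F :
  radical (minors_ideal (tnth a i).+1 (M i.+1)) F -> K (lift_poly A F).
Proof.
move=> RF; exists 0, (lift_poly A F); rewrite add0r; split=> //.
  by case: (ideal_gen_ideal (range (@gen_form k A d m x))).
apply: sub_ideal_gen; exists F => //.
apply: (sub_big_ideal_add (I := fun n : 'I_r => radical (minors_ideal (tnth a n).+1 (M n.+1)))) RF => [j|].
  by apply: radical0; apply: ideal_gen_ideal.
exact: mem_index_enum.
Qed.

Lemma lift_poly_morph : [/\ @lift_poly k A d m 0 = 0, {morph @lift_poly k A d m : u v / u + v}
  & {morph @lift_poly k A d m : u v / u * v}].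
Proof. by split; rewrite /lift_poly; [exact: rmorph0|exact: rmorphD|exact: rmorphM]. Qed.

(** Modulo the generic linear forms, [D * w] is the combination of the basis
    with the Cramer residue as coefficients; the remaining terms are
    combinations of rows of [M n.+1], each being the coordinate row of a
    multiple of a generic form. *)
Lemma cramer_bracket (n t : nat) (f : 'I_t -> 'I_(d * h n)) (g : 'I_t -> 'I_(h n.+1))
    (u : 'rV[k]_(h n.+1)) (j : {mpoly k[d * m]}) :
  (forall c, K (lift_poly A (j * cramer_residue (M n.+1) f g (map_mx (@mpolyC _ k) u) 0 c))) ->
  K ((\sum_l u 0 l *: @b n.+1 l)%:MP * lift_poly A (j * \det (mxsub f g (M n.+1)))).
Proof.
have [L0 LD LM] := lift_poly_morph; have [K0 KD KM] := bracket_ideal.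
set D := \det _; set w := map_mx _ _; move=> resK.
pose lam := colsub g w *m \adj (mxsub f g (M n.+1)).
have wE l : D * w 0 l = cramer_residue (M n.+1) f g w 0 l + (lam *m rowsub f (M n.+1)) 0 l.
  by rewrite /cramer_residue -/D -/lam !mxE subrK.
have -> : (\sum_l u 0 l *: @b n.+1 l)%:MP * lift_poly A (j * D) =
  \sum_l lift_poly A (j * cramer_residue (M n.+1) f g w 0 l) * (@b n.+1 l)%:MP +
  \sum_i lift_poly A (j * lam 0 i) * \sum_l lift_poly A (M n.+1 (f i) l) * (@b n.+1 l)%:MP.
  rewrite rmorph_sum mulr_suml.
  rewrite (eq_bigr (fun l => lift_poly A (j * (D * w 0 l)) * (@b n.+1 l)%:MP)); last first.
    move=> l _ /=; have -> : w 0 l = (u 0 l)%:MP by rewrite mxE.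
    have lC : @lift_poly k A d m (u 0 l)%:MP = ((u 0 l)%:A)%:MP by exact: map_mpolyC.
    rewrite !LM lC -(mulr_algl (u 0 l) (@b n.+1 l)) mpolyCM mulrAC.
    by rewrite [X in X * _ = _]mulrC -[X in X * _ = _]mulrA.
  under [X in _ = _ + X]eq_bigr => i _ do rewrite mulr_sumr.
  rewrite exchange_big -big_split; apply: eq_bigr => l _ /=.
  rewrite wE mulrDr LD mulrDl; congr (_ + _).
  rewrite mxE mulr_sumr (big_morph _ LD L0) mulr_suml; apply: eq_bigr => i _.
  by rewrite [rowsub _ _ _ _]mxE mulrA LM mulrA.
have idK := bracket_ideal.
apply: KD; first by apply: (ideal_sum _ idK) => l _; apply: (idealMr _ idK); apply: resK.
apply: (ideal_sum _ idK) => i _.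
apply: (KM); apply: gen_ideal_bracket.
case/mxvec_indexP: (f i) => p q; rewrite -(hM (ltn0Sn n)).
have idg : is_ideal (gen_ideal d x) by exact: ideal_gen_ideal.
by apply: (idealMr _ idg); apply: sub_ideal_gen; exists p.
Qed.

(** In degree [r + 1] the pivot columns of a maximal minor are all the
    columns, so the Cramer residue is zero. *)
Lemma full_minor_bracket F w n : minors_ideal (h r.+1) (M r.+1) F -> (r < n)%N ->
  gr n w -> K (w%:MP * lift_poly A F).
Proof.
have [L0 LD LM] := lift_poly_morph; have idK := bracket_ideal; have [K0 KD KM] := idK.
move=> JF rn; apply: (gr_ge_sub hA hx (K := [set w | K (w%:MP * lift_poly A F)]) _ rn) => {w n rn}.
  split=> /= [|u v Ku Kv|c u Ku]; first by rewrite mpolyC0 mul0r.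
    by rewrite mpolyCD mulrDl; apply: KD.
  by rewrite mpolyCM -mulrA; apply: KM.
move=> w gw /=; move: F JF; apply: ideal_gen_sub.
  split=> /= [|u v Ku Kv|c u Ku]; first by rewrite L0 mulr0.
    by rewrite LD mulrDr; apply: KD.
  by rewrite LM mulrCA; apply: KM.
move=> _ [f [g [_ ginc ->]]] /=; have [u ->] := basis_coord hb gw.
rewrite -[\det _]mul1r; apply: cramer_bracket => c.
have ginj : injective g.
  by move=> i j /eqP gij; apply/val_inj/eqP; case: ltngtP gij => // /ginc; rewrite ltn_neqAle => /andP [/negPf]; rewrite -?val_eqE // eq_sym => ->.
have /codomP [c' ->] := injF_onto ginj c.
by rewrite cramer_residue_pivot mulr0 L0.
Qed.

(** The entries of the Cramer residue, multiplied by an element of [J], vanish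
    at all zeros of the ideal of the [a_i + 1]-minors: at a zero which is not
    good [J] vanishes, and at a good one [w] lies in the special ideal. *)
Lemma minor_bracket (i : 'I_r) j F w : minors_ideal (h r.+1) (M r.+1) j ->
  minors_ideal (tnth a i) (M i.+1) F -> core gr w -> gr i.+1 w ->
  K (w%:MP * lift_poly A (j * F)).
Proof.
have [L0 LD LM] := lift_poly_morph; have idK := bracket_ideal; have [K0 KD KM] := idK.
move=> Jj + cw gw; move: F; apply: ideal_gen_sub.
  split=> /= [|u v Ku Kv|c u Ku]; first by rewrite mulr0 L0 mulr0.
    by rewrite mulrDr LD mulrDr; apply: KD.
  by rewrite mulrCA LM mulrCA; apply: KM.
move=> _ [f [g [_ _ ->]]] /=; have [D0|D0] := eqVneq (\det (mxsub f g (M i.+1))) 0.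
  by rewrite D0 mulr0 L0 mulr0.
have [u wE] := basis_coord hb gw; rewrite [in X in K X]wE; apply: cramer_bracket => c.
apply: (@radical_bracket i); apply: nullstellensatz; first exact: ideal_gen_ideal.
move=> v vanish; pose a' : 'M[k]_(d, m) := vec_mx (\row_l v l).
have a'v F : F.@[mxvec a' 0] = F.@[v].
  by apply: meval_eq => l; rewrite vec_mxK mxE.
rewrite mevalM; have [ga|nga] := pselect (good a'); last first.
  suff -> : j.@[v] = 0 by rewrite mul0r.
  rewrite -a'v; apply: (proj2 (special_minors M r.+1 (h r.+1) a')) => //.
  by rewrite ltn_neqAle rank_leq_col andbT; apply/eqP.
suff -> : (cramer_residue (M i.+1) f g (map_mx (@mpolyC _ k) u) 0 c).@[v] = 0 by rewrite mulr0.
rewrite -a'v; apply: cramer_residue_specialize => //.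
  have -> : map_mx (meval (mxvec a' 0)) (map_mx (@mpolyC _ k) u) = u.
    by apply/rowP => l; rewrite !mxE /= mevalC.
  apply/(special_ideal_coord hA hx hb hM); rewrite -wE; exact: core_sub_good.
rewrite -ltnS; apply/(special_minors M) => F IF; rewrite a'v; exact: vanish.
Qed.

(** Both sides are compatible with the homogeneous decomposition of [w], and
    the product ideal is contained in [J] and in the product of [J] with each
    single factor. *)
Lemma core_sub_bracket w :
  core gr w -> ideal_colon K (ideal_ext A (ideal_mul (minors_ideal (h r.+1) (M r.+1)) (minors_prod M a))) w%:MP.
Proof.
have [L0 LD LM] := lift_poly_morph; have idK := bracket_ideal; have [K0 KD KM] := idK.
set J := ideal_ext A _; have [C0 CD _] := ideal_colon_ideal J idK.
move=> cw; have [N wE] := hcompE hA w; rewrite wE rmorph_sum.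
apply: (big_ind (ideal_colon K J)) => // n _; move: (nat_of_ord n) => {}n.
have cn := core_hcomp n cw; have gn := hcomp_gr hA w n.
move: (hc w n) cn gn => {wE cw N} {}w cw gw.
suff sub : ideal_mul (minors_ideal (h r.+1) (M r.+1)) (minors_prod M a) `<=`
    [set F | K (w%:MP * lift_poly A F)].
  move=> Y JY; apply: (ideal_gen_sub (I := [set Y | K (w%:MP * Y)])) JY.
    split=> /= [|u v Ku Kv|c u Ku]; first by rewrite mulr0.
      by rewrite mulrDr; apply: KD.
    by rewrite mulrCA; apply: KM.
  by move=> _ [F JF <-]; apply: sub.
apply: ideal_gen_sub.
  split=> /= [|u v Ku Kv|c u Ku]; first by rewrite L0 mulr0.
    by rewrite LD mulrDr; apply: KD.
  by rewrite LM mulrCA; apply: KM.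
move=> _ [j [F [Jj PF ->]]] /=; case: n gw => [|n] gw.
  by rewrite (core_degree0 cw gw) mpolyC0 mul0r.
have [nr|rn] := ltnP n r.
  apply: (@minor_bracket (Ordinal nr)) => //; apply: (big_ideal_mul_sub (I := fun i : 'I_r => minors_ideal (tnth a i) (M i.+1))) PF => [i|].
    exact: ideal_gen_ideal.
  exact: mem_index_enum.
by rewrite LM mulrA; apply: idealMr => //; apply: (@full_minor_bracket _ _ n.+1).
Qed.
End Bracket.

(** If the specialized matrix is zero in degree [n + 1 <= r], the special
    forms annihilate [gr n], hence also [gr r], and the special ideal is zero
    in degree [r + 1]. *)
Lemma good_rank_gt0 (a : 'M[k]_(d, m)) n : (n < r)%N -> good a -> (0 < \rank (Ma n.+1 a))%N.
Proof.
move=> nr ga; rewrite lt0n; apply/eqP => /eqP; rewrite mxrank_eq0 => /eqP M0.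
have ann i : gr n `<=` [set u | special_form x a i * u = 0].
  move=> u /(basis_coord hb) [v ->]; rewrite /= mulr_sumr big1 // => l _.
  rewrite -scalerAr (special_mxP hM) M0 big1 ?scaler0 // => l' _.
  by rewrite mxE scale0r.
have annr i : gr r `<=` [set u | special_form x a i * u = 0].
  apply: (gr_ge_sub hA hx _ (ltnW nr) (ann i)); split=> /= [|u v u0 v0|c u u0].
  - by rewrite mulr0.
  - by rewrite mulrDr u0 v0 addr0.
  - by rewrite mulrCA u0 mulr0.
have Mr0 : Ma r.+1 a = 0.
  apply/row_matrixP => s; case/mxvec_indexP: s => i l; apply: (basis_inj hb).
  rewrite [LHS](eq_bigr (fun l' => Ma r.+1 a (mxvec_index i l) l' *: @b r.+1 l')); last first.
    by move=> l' _; rewrite mxE.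
  rewrite -(special_mxP hM) (annr i (@b r l)); last by case: (hb r) => -[].
  by rewrite big1 // => l' _; rewrite !mxE scale0r.
apply: (@gr_nonzero r.+1) => u /(basis_coord hb) [v ->] /=.
have hr0 : h r.+1 = 0%N by rewrite -ga Mr0 mxrank0.
by rewrite big1 // => l; have := ltn_ord l; rewrite [X in (_ < X)%N]hr0.
Qed.

(** At [u = a] the left-hand ideal specializes into the special ideal, and the
    product of ideals of minors contains an element with nonzero value. *)
Lemma bracket_sub_special (a : 'M[k]_(d, m)) (t : r.-tuple nat) w : good a ->
  (forall i : 'I_r, tnth t i = \rank (Ma i.+1 a)) ->
  ideal_colon (ideal_add (gen_ideal d x) (ideal_ext A (radical_sum M t)))
    (ideal_ext A (ideal_mul (minors_ideal (h r.+1) (M r.+1)) (minors_prod M t))) w%:MP ->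
  Qa a w.
Proof.
move=> ga tE colon; have idQ := special_ideal_ideal a; have [Q0 QD QM] := idQ.
have nonvanish n s : (s <= \rank (Ma n a))%N ->
    exists F, minors_ideal s (M n) F /\ F.@[mxvec a 0] != 0.
  move=> sr; apply: contrapT => none; move: sr; rewrite leqNgt => /negP; apply.
  apply/(special_minors M) => F IF; apply: contrapT => /eqP F0; apply: none.
  by exists F.
have [j [Jj j0]] := nonvanish r.+1 (h r.+1) (eq_leq (esym ga)).
have /choice [F FP] (i : 'I_r) := nonvanish i.+1 (tnth t i) (eq_leq (tE i)).
have [L0 LD LM] := lift_poly_morph.
have : ideal_ext A (ideal_mul (minors_ideal (h r.+1) (M r.+1)) (minors_prod M t))
    (lift_poly A (j * \prod_i F i)).
  apply: sub_ideal_gen; exists (j * \prod_i F i) => //.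
  apply: sub_ideal_gen; exists j, (\prod_i F i); split=> //.
  by apply: big_ideal_mul_prod => i; case: (FP i).
move=> /colon [q [s [genq exts E]]].
have := congr1 (special_eval a) E.
rewrite special_evalM special_evalC special_eval_lift special_evalD.
have -> : special_eval a s = 0.
  move: s exts {E}; apply: ideal_gen_sub.
    split=> /= [|u v u0 v0|c u u0]; first exact: meval0.
      by rewrite special_evalD u0 v0 addr0.
    by rewrite special_evalM u0 mulr0.
  move=> _ [G RG <-] /=; rewrite special_eval_lift.
  suff -> : G.@[mxvec a 0] = 0 by rewrite scale0r.
  move: G RG; apply: big_ideal_add_sub.
    split=> /= [|u v u0 v0|c u u0]; first exact: meval0.
      by rewrite mevalD u0 v0 addr0.
    by rewrite mevalM u0 mulr0.
  move=> i G [e Ge] /=; have : (G ^+ e).@[mxvec a 0] = 0.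
    apply: (proj2 (special_minors M i.+1 (tnth t i).+1 a)) => //.
    by rewrite ltnS tE.
  by rewrite rmorphXn /= => /eqP; rewrite expf_eq0 => /andP [_ /eqP].
rewrite addr0; set c := _.@[_]; have c0 : c != 0.
  by rewrite /c mevalM rmorph_prod mulf_neq0 //; apply/prodf_neq0 => i _; case: (FP i).
move=> wc; have : Qa a (w * c%:A).
  rewrite wc; move: q genq {E wc}; apply: ideal_gen_sub.
    split=> /= [|u v Qu Qv|u v Qv]; first by rewrite [special_eval a 0]meval0.
      by rewrite special_evalD; apply: QD.
    by rewrite special_evalM; apply: QM.
  by move=> _ [i _ <-] /=; rewrite special_eval_form; apply: sub_ideal_gen; exists i.
move=> /(QM (c^-1)%:A); rewrite mulrCA -scalerAl mul1r scalerA mulVf // scale1r.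
by rewrite mulr1.
Qed.

(** The sequence of ranks at a good point is admissible. *)
Lemma core_formula :
  core gr = \bigcap_(t in admissible M r) (@mpolyC (d * m) A @^-1`
    (ideal_colon (ideal_add (gen_ideal d x) (ideal_ext A (radical_sum M t)))
      (ideal_ext A (ideal_mul (minors_ideal (h r.+1) (M r.+1)) (minors_prod M t))))).
Proof.
apply/seteqP; split=> [w cw t _|w wt]; first exact: core_sub_bracket.
apply: good_sub_core => a a0 ga.
pose t : r.-tuple nat := [tuple \rank (Ma i.+1 a) | i < r].
have tE i : tnth t i = \rank (Ma i.+1 a) by rewrite tnth_mktuple.
apply: (@bracket_sub_special a t) => //; apply: wt; split=> [i|].
  by rewrite tE; apply: good_rank_gt0.
have [L aL] := line_mem a0; exists L => i _; split.
  apply/rank_locusP => a' a'L _; have [c ->] := line_scale aL a0 a'L.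
  by rewrite (special_mx_scale hb hM) ltnS tE mxrankS // scalemx_sub.
case.
  by move=> /rank_locusP /(_ a aL a0); rewrite tE ltnn.
move=> /full_locusP /(_ a aL a0); apply.
exact/(special_mx_full hA hx hb hM).
Qed.

End Core.

Theorem theorem1p6 (k : closedFieldType) (A : comAlgType k)
    (gr : nat -> set A) (d m r : nat) (x : 'I_m -> A)
    (h : nat -> nat) (b : forall n, 'I_(h n) -> A)
    (M : forall n, 'M[{mpoly k[d * m]}]_(d * h n.-1, h n))
    (hA : standard_graded gr)
    (hd : krull_dim_eq A d) (d_ge1 : (1 <= d)%N)
    (hx : lin_spans (gr 1%N) x)
    (hb : forall n, lin_basis (gr n) (b n))
    (hM : forall n, (1 <= n)%N -> is_coef_matrix x (b n.-1) (b n) (M n))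
    (hr : is_last_jump M r) :
  let J := minors_ideal (h r.+1) (M r.+1) in
  core gr =
  \bigcap_(a in admissible M r)
    (@mpolyC (d * m) A @^-1`
       (ideal_colon
          (ideal_add (gen_ideal d x) (ideal_ext A (radical_sum M a)))
          (ideal_ext A (ideal_mul J (minors_prod M a))))).
Proof. exact: (core_formula hA hx hb hM hd d_ge1 hr). Qed.
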